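(* The set of all nilpotent semigroup varieties is definable. For every natural number $k$, the semigroup variety $\mathcal{NILP}_k=\operatorname{var}\{x_1x_2\cdots x_k=0\}$ is definable.
   Context: $\mathbf{SEM}$ denotes the lattice of all semigroup varieties, ordered by inclusion, with join $\vee$ and meet $\wedge$. A subset $A$ of a lattice $\langle L;\vee,\wedge\rangle$ is called definable in $L$ if there is a first-order formula $\Phi(x)$ with one free variable $x$ (and no parameters) in the language of the lattice operations $\vee$ and $\wedge$ such that, for every $a\in L$, the sentence $\Phi(a)$ is true in $L$ if and only if $a\in A$. A set of semigroup varieties is called definable if it is definable in $\mathbf{SEM}$; a single semigroup variety $\mathcal X$ is called definable if $\{\mathcal X\}$ is definable in $\mathbf{SEM}$. $\operatorname{var}\Sigma$ denotes the semigroup variety given by the identity system $\Sigma$. The symbolic identity $w=0$ stands for the pair of identities $wx=xw=w$, where $x$ is a letter not occurring in the word $w$. A semigroup variety is nilpotent if all its members are nilpotent semigroups (a semigroup $S$ with zero is nilpotent if $S^k=\{0\}$ for some natural number $k$). *)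

(* Defs.v *)
From HB Require Import structures.
From mathcomp Require Import all_boot all_order.
From mathcomp Require Import boolp classical_sets.

Set Implicit Arguments.
Unset Strict Implicit.
Unset Printing Implicit Defensive.

Import Order.TTheory.

Local Open Scope classical_set_scope.

(** * First-order definability in a lattice *)

(* The variables are de Bruijn indices in ['I_n]: [formula n] is the type of
   formulas whose free variables are among [n] given ones, and index [0]
   denotes the variable bound by the innermost quantifier. *)
Inductive lterm (n : nat) : Type :=
| LVar of 'I_n
| LJoin of lterm n & lterm n
| LMeet of lterm n & lterm n.

Inductive formula : nat -> Type :=
| FEq n of lterm n & lterm n : formula n
| FNot n of formula n : formula n
| FAnd n of formula n & formula n : formula n
| FOr n of formula n & formula n : formula n
| FImp n of formula n & formula n : formula n
| FAll n of formula n.+1 : formula n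
| FEx n of formula n.+1 : formula n.

Definition env_cons (L : Type) (n : nat) (x : L) (e : 'I_n -> L) : 'I_n.+1 -> L :=
  fun i => if unlift ord0 i is Some j then e j else x.

Fixpoint lterm_eval (d : Order.disp_t) (L : latticeType d) (n : nat)
    (e : 'I_n -> L) (t : lterm n) : L :=
  match t with
  | LVar i => e i
  | LJoin s t => Order.join (lterm_eval e s) (lterm_eval e t)
  | LMeet s t => Order.meet (lterm_eval e s) (lterm_eval e t)
  end.

Fixpoint holds (d : Order.disp_t) (L : latticeType d) (n : nat)
    (phi : formula n) : ('I_n -> L) -> Prop :=
  match phi in formula n return ('I_n -> L) -> Prop with
  | FEq _ s t => fun e => lterm_eval e s = lterm_eval e t
  | FNot _ p => fun e => ~ holds p e
  | FAnd _ p q => fun e => holds p e /\ holds q e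
  | FOr _ p q => fun e => holds p e \/ holds q e
  | FImp _ p q => fun e => holds p e -> holds q e
  | FAll _ p => fun e => forall x : L, holds p (env_cons x e)
  | FEx _ p => fun e => exists x : L, holds p (env_cons x e)
  end.

Definition definable (d : Order.disp_t) (L : latticeType d) (A : set L) : Prop :=
  exists phi : formula 1, forall a : L, holds phi (fun=> a) <-> A a.

(** * Semigroups *)

(* MathComp's [semigroupType] is not used because the type of classes of
   [semigroupType]s is too large to be the carrier of a [latticeType]; it also
   admits the empty carrier, whereas semigroups are nonempty here. *)
Record semigroup : Type := MkSemigroup {
  carrier :> Type;
  sgmul : carrier -> carrier -> carrier;
  sgmulA : associative sgmul;
  sg_nonempty : inhabited carrier
}.

Definition is_zero (S : semigroup) (z : S) : Prop :=
  forall x : S, sgmul z x = z /\ sgmul x z = z.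

Definition setmul (S : semigroup) (A B : set S) : set S :=
  [set sgmul a b | a in A & b in B].

(* [sgpow S k] is S^k for [0 < k]; [sgpow S 0] is a junk value. *)
Definition sgpow (S : semigroup) (k : nat) : set S :=
  iter k.-1 (fun A => setmul A setT) setT.
Arguments sgpow : clear implicits.

Definition nilpotent_semigroup (S : semigroup) : Prop :=
  exists2 z : S, is_zero z & exists2 k : nat, 0 < k & sgpow S k = [set z].

(** * Words and identities *)

(* The alphabet is [nat]; a word is nonempty, given by its first letter and the
   sequence of the remaining ones. *)
Definition word : Type := (nat * seq nat)%type.

Definition letters (w : word) : seq nat := w.1 :: w.2.

Definition word_eval (S : semigroup) (f : nat -> S) (w : word) : S :=
  foldl (fun a y => sgmul a (f y)) (f w.1) w.2.

Definition identity : Type := (word * word)%type.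

Definition satisfies (S : semigroup) (e : identity) : Prop :=
  forall f : nat -> S, word_eval f e.1 = word_eval f e.2.

Definition fresh (w : word) : nat := (\max_(y <- letters w) y).+1.

Lemma fresh_notin (w : word) : fresh w \notin letters w.
Proof.
apply/negP => wx; have := @leq_bigmax_seq _ (letters w) xpredT id _ wx isT.
by rewrite ltnn.
Qed.

(* The identity system w = 0, that is wx = xw = w with x := fresh w. *)
Definition zero_identities (w : word) : set identity :=
  [set ((w.1, rcons w.2 (fresh w)), w); ((fresh w, letters w), w)].

(** * The lattice SEM of semigroup varieties *)

Definition models (Sigma : set identity) : set semigroup :=
  [set S | forall e, Sigma e -> satisfies S e].

Record variety : Type := MkVariety {
  members :> set semigroup;
  membersP : exists Sigma, members = models Sigma
}.

Definition var (Sigma : set identity) : variety :=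
  MkVariety (ex_intro _ Sigma erefl).

Definition theory (V : set semigroup) : set identity :=
  [set e | forall S, V S -> satisfies S e].

Lemma variety_ext (V W : variety) : members V = members W -> V = W.
Proof.
case: V W => [V hV] [W hW] /= eVW; case: _ / eVW in hW *.
by congr MkVariety; apply: Prop_irrelevance.
Qed.

Lemma models_theory (V : variety) : models (theory V) = V.
Proof.
have [Sigma ->] := membersP V; apply/seteqP; split=> S; last by move=> VS e; apply.
by move=> VS e Se; apply: VS => T; apply.
Qed.

Lemma modelsU (A B : set identity) : models (A `|` B) = models A `&` models B.
Proof.
apply/seteqP; split=> S; first by move=> h; split=> e he; apply: h; [left|right].
by move=> [hA hB] e [/hA|/hB].
Qed.

Lemma meet_subproof (V W : variety) : exists Sigma, V `&` W = models Sigma.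
Proof. by exists (theory V `|` theory W); rewrite modelsU !models_theory. Qed.

Definition variety_le (V W : variety) : bool := `[< V `<=` W >].
Definition variety_meet (V W : variety) : variety :=
  MkVariety (meet_subproof V W).
Definition variety_join (V W : variety) : variety :=
  var (theory V `&` theory W).

Lemma variety_le_refl : reflexive variety_le.
Proof. by move=> V; apply/asboolP. Qed.

Lemma variety_le_anti : antisymmetric variety_le.
Proof.
move=> V W /andP[/asboolP VW /asboolP WV].
by apply: variety_ext; apply/seteqP.
Qed.

Lemma variety_le_trans : transitive variety_le.
Proof.
by move=> W V U /asboolP VW /asboolP WU; apply/asboolP; apply: subset_trans WU.
Qed.

Fact variety_display : Order.disp_t. Proof. exact: Order.Disp tt tt. Qed.

HB.instance Definition _ := gen_eqMixin variety.
HB.instance Definition _ := gen_choiceMixin variety.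
HB.instance Definition _ := Order.Le_isPOrder.Build variety_display variety
  variety_le_refl variety_le_anti variety_le_trans.

Lemma variety_meetP (U V W : variety) :
  variety_le U (variety_meet V W) = variety_le U V && variety_le U W.
Proof.
apply/asboolP/andP => [UVW|[/asboolP UV /asboolP UW] S US].
  by split; apply/asboolP => S /UVW[].
by split; [apply: UV|apply: UW].
Qed.

Lemma variety_joinP (U V W : variety) :
  variety_le (variety_join U V) W = variety_le U W && variety_le V W.
Proof.
apply/asboolP/andP => [UVW|[/asboolP UW /asboolP VW] S US].
  by split; apply/asboolP => S VS; apply: UVW => e [h1 h2]; [apply: h1|apply: h2].
rewrite -models_theory => e We; apply: US.
by split=> T hT; apply: We; [apply: UW|apply: VW].
Qed.

HB.instance Definition _ :=
  Order.POrder_MeetJoin_isLattice.Build variety_display variety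
    variety_meetP variety_joinP.

Definition SEM : latticeType variety_display := variety.

Definition nilpotent_variety (V : variety) : Prop :=
  forall S, members V S -> nilpotent_semigroup S.

(* The word x_1 x_2 ... x_k, for [0 < k]. *)
Definition linear_word (k : nat) : word := (0, iota 1 k.-1).

Definition NILP (k : nat) : variety := var (zero_identities (linear_word k)).

(* Main.v *)
From HB Require Import structures.
Require Import Defs.
From mathcomp Require Import all_boot all_order.
From mathcomp Require Import boolp classical_sets.

(** Nilpotent varieties are described from within the lattice in three stages.

    The first stage finds ZM, the variety of null semigroups, xy = zt. Let [z]
    be a nontrivial variety that lies strictly below some variety all of whose
    nontrivial subvarieties contain [z]. Such a [z] is contained in its own
    nontrivial subvarieties. If [z] contains no semilattices, no left or right
    zero semigroups and no groups of prime exponent, then it is a nil-variety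
    ([nil_of_not_le]), hence contains ZM and equals it. Semilattices and left
    or right zero semigroups generate varieties with no proper extension of the
    required sort ([not_monolith_SL] and its companions). The groups of exponent
    p are excluded by the condition that V <= U <= V \/ z implies U <= V or
    z <= U, which ZM satisfies ([join_covered_ZM]) and which fails for them
    ([not_join_covered_AB]). Nil-varieties are then the varieties whose
    nontrivial subvarieties all contain ZM ([nil_varietyP]).

    The second stage finds COMNIL, given by xy = yx and x^2 = 0. A
    nil-variety satisfying an identity between a linear word u and a word that
    is not a permutation of u satisfies u = 0
    ([NILP_of_linear_identity]), and an identity that fails in COMNIL yields
    one of this sort. So a nil-variety not containing COMNIL is nilpotent, and
    conversely. A nilpotent variety has only finitely many subvarieties, hence
    a maximal proper one if it is nontrivial ([not_dense_below]), while every
    proper subvariety of COMNIL lies properly below another one. So COMNIL is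
    the least nontrivial nil-variety without maximal proper subvarieties
    ([lattice_comnilP]), and nilpotency is definable.

    For the last stage, let COMNILP k be the subvariety of COMNIL given by
    x_1...x_k = 0. The proper subvarieties of COMNIL form the chain
    COMNILP 1 < COMNILP 2 < ..., whose members are therefore definable one after
    the other, and NILP_k is the greatest nilpotent variety that does not
    contain COMNILP (k + 1) ([lattice_NILPP]). *)

Set Implicit Arguments.
Unset Strict Implicit.
Unset Printing Implicit Defensive.

Import Order.TTheory.

Local Open Scope classical_set_scope.

(** * Words and their values *)

Lemma letters_inj : injective letters.
Proof. by case=> [a s] [b t] /= [-> ->]. Qed.

Definition to_word (s : seq nat) : word := (head 0 s, behead s).

Lemma letters_to_word s : 0 < size s -> letters (to_word s) = s.
Proof. by case: s. Qed.

Definition wmul (u w : word) : word := (u.1, u.2 ++ letters w).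

Lemma letters_wmul u w : letters (wmul u w) = letters u ++ letters w.
Proof. by []. Qed.

Definition subst (sigma : nat -> word) (u : word) : word :=
  to_word (flatten [seq letters (sigma y) | y <- letters u]).

Lemma letters_subst sigma u :
  letters (subst sigma u) = flatten [seq letters (sigma y) | y <- letters u].
Proof. by rewrite letters_to_word. Qed.

Lemma subst_wmul sigma u w :
  subst sigma (wmul u w) = wmul (subst sigma u) (subst sigma w).
Proof.
apply: letters_inj.
by rewrite letters_subst !letters_wmul !letters_subst map_cat flatten_cat.
Qed.

Definition letter (y : nat) : word := (y, [::]).

Lemma subst_letter sigma y : subst sigma (letter y) = sigma y.
Proof. by apply: letters_inj; rewrite letters_subst /= cats0. Qed.

Lemma word_rcons a s y : (a, rcons s y) = wmul (a, s) (letter y) :> word.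
Proof. by rewrite /wmul /= cats1. Qed.

Lemma word_ind_rcons (P : word -> Prop) :
    (forall y, P (letter y)) -> (forall u y, P u -> P (wmul u (letter y))) ->
  forall u, P u.
Proof.
move=> Pl Pm [a s]; elim/last_ind: s => [|s y IHs]; first exact: Pl.
by rewrite word_rcons; apply: Pm.
Qed.

Lemma subst_id u : subst letter u = u.
Proof.
elim/word_ind_rcons: u => [y|u y IHu]; first exact: subst_letter.
by rewrite subst_wmul IHu subst_letter.
Qed.

Lemma word_eval_rcons (S : semigroup) (f : nat -> S) u y :
  word_eval f (wmul u (letter y)) = sgmul (word_eval f u) (f y).
Proof. by case: u => a s; rewrite /word_eval /= cats1 foldl_rcons. Qed.

(** Adjoining a unit lets the library of monoids and big operators handle the
    values of words, which are products over nonempty sequences. *)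
Definition unitized (S : semigroup) : Type := option S.

Section Unitized.
Variable S : semigroup.

Definition umul (a b : unitized S) : unitized S :=
  match a, b with
  | Some x, Some y => Some (sgmul x y)
  | Some x, None => Some x
  | None, _ => b
  end.

Lemma umulA : associative umul.
Proof. by move=> [x|] [y|] [z|] //=; rewrite sgmulA. Qed.

Lemma umul1 : left_id None umul. Proof. by []. Qed.
Lemma umulr1 : right_id None umul. Proof. by case. Qed.

HB.instance Definition _ := gen_eqMixin (unitized S).
HB.instance Definition _ := gen_choiceMixin (unitized S).
HB.instance Definition _ :=
  isMonoid.Build (unitized S) umulA umul1 umulr1.

Definition inj_unitized (x : S) : unitized S := Some x.

Definition nonunit (a : unitized S) : Prop := a <> 1%g.

Lemma nonunit_inj x : nonunit (inj_unitized x). Proof. by []. Qed.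

Lemma nonunitP a : nonunit a -> exists x, a = inj_unitized x.
Proof. by case: a => [x|] // _; exists x. Qed.

Lemma nonunit_mulr a b : nonunit a -> nonunit (a * b)%g.
Proof. by case: a b => [x|] [y|]. Qed.

Lemma nonunit_exp a n : 0 < n -> nonunit a -> nonunit (a ^+ n)%g.
Proof. by case: n => // n _ Pa; rewrite expgS; apply: nonunit_mulr. Qed.

Lemma inj_unitizedM x y :
  inj_unitized (sgmul x y) = (inj_unitized x * inj_unitized y)%g.
Proof. by []. Qed.

Lemma inj_unitized_inj : injective inj_unitized.
Proof. by move=> x y []. Qed.

Lemma word_evalE (f : nat -> S) u :
  inj_unitized (word_eval f u) = (\prod_(y <- letters u) inj_unitized (f y))%g.
Proof.
elim/word_ind_rcons: u => [y|u y IHu]; first by rewrite big_seq1.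
by rewrite word_eval_rcons inj_unitizedM IHu letters_wmul big_cat big_seq1.
Qed.

Lemma nonunit_prod (g : nat -> unitized S) u :
  (forall y, nonunit (g y)) -> nonunit (\prod_(y <- letters u) g y)%g.
Proof. by move=> Pg; rewrite big_cons; apply: nonunit_mulr. Qed.

Lemma satisfies_prod (g : nat -> unitized S) u w :
    satisfies S (u, w) -> (forall y, nonunit (g y)) ->
  (\prod_(y <- letters u) g y = \prod_(y <- letters w) g y)%g.
Proof.
move=> Suw Pg; pose f y := sval (cid (nonunitP (Pg y))).
have gE y : g y = inj_unitized (f y) by rewrite /f; case: cid.
under eq_bigr do rewrite gE; under [RHS]eq_bigr do rewrite gE.
by rewrite -!word_evalE Suw.
Qed.

Lemma prod_satisfies u w :
    (forall g : nat -> unitized S, (forall y, nonunit (g y)) ->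
       \prod_(y <- letters u) g y = \prod_(y <- letters w) g y)%g ->
  satisfies S (u, w).
Proof.
move=> uw f; apply: inj_unitized_inj; rewrite !word_evalE; exact: uw.
Qed.

End Unitized.

Arguments nonunit_inj {S} x.

Lemma prod_subst (M : monoidType) (g : nat -> M) sigma u :
  (\prod_(y <- letters (subst sigma u)) g y =
   \prod_(y <- letters u) \prod_(z <- letters (sigma y)) g z)%g.
Proof. by rewrite letters_subst big_flatten big_map. Qed.

(** * Varieties and their equational theories *)

Lemma le_membersP (V W : variety) :
  (V <= W)%O <-> forall S, members V S -> members W S.
Proof. by split=> [/asboolP|VW]; [|apply/asboolP]. Qed.

Lemma memP (V : variety) S :
  members V S <-> forall e, theory V e -> satisfies S e.
Proof.
split=> [VS e Ve|Se]; first exact: Ve.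
by rewrite -models_theory => e; apply: Se.
Qed.

Lemma le_theoryP (V W : variety) :
  (V <= W)%O <-> forall e, theory W e -> theory V e.
Proof.
rewrite le_membersP; split=> [VW e We S /VW|VW S /memP Se]; first exact: We.
by apply/memP=> e /VW; apply: Se.
Qed.

Lemma theory_refl (V : variety) u : theory V (u, u). Proof. by []. Qed.

Lemma theory_sym (V : variety) u w : theory V (u, w) -> theory V (w, u).
Proof. by move=> Vuw S VS f; rewrite [LHS](esym (Vuw S VS f)). Qed.

Lemma theory_trans (V : variety) u v w :
  theory V (u, v) -> theory V (v, w) -> theory V (u, w).
Proof. by move=> uv vw S VS f; rewrite [LHS](uv S VS f); apply: vw. Qed.

Lemma theory_mul (V : variety) u u' w w' :
  theory V (u, u') -> theory V (w, w') -> theory V (wmul u w, wmul u' w').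
Proof.
move=> Vu Vw S VS; apply: prod_satisfies => g Pg.
rewrite !letters_wmul !big_cat /=.
by rewrite (satisfies_prod (Vu S VS) Pg) (satisfies_prod (Vw S VS) Pg).
Qed.

Lemma theory_subst (V : variety) sigma u w :
  theory V (u, w) -> theory V (subst sigma u, subst sigma w).
Proof.
move=> Vuw S VS; apply: prod_satisfies => g Pg; rewrite !prod_subst.
by apply: satisfies_prod (Vuw S VS) _ => y; apply: nonunit_prod.
Qed.

(** The equational theories of varieties are the fully invariant congruences on
    words. They are handled as kernels of maps, which makes them equivalence
    relations by construction. *)
Definition fully_invariant (X : Type) (N : word -> X) : Prop :=
  (forall u u' w w', N u = N u' -> N w = N w' -> N (wmul u w) = N (wmul u' w'))
  /\ (forall sigma u w, N u = N w -> N (subst sigma u) = N (subst sigma w)).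

Definition kvar (X : Type) (N : word -> X) : variety :=
  var [set e | N e.1 = N e.2].

Section Kernel.
Variables (X : Type) (N : word -> X).
Hypothesis Ninv : fully_invariant N.

(** The relatively free semigroup of countable rank, realized on the image of
    [N]. *)
Definition quotient : Type := {x : X | exists u, N u = x}.
Definition qclass (u : word) : quotient := exist _ (N u) (ex_intro _ u erefl).
Definition qrepr (x : quotient) : word := sval (cid (svalP x)).
Definition qmul (x y : quotient) : quotient :=
  qclass (wmul (qrepr x) (qrepr y)).

Lemma qclassP u w : qclass u = qclass w <-> N u = N w.
Proof. by split=> [[]|uw] //; apply: eq_exist. Qed.

Lemma qreprK x : qclass (qrepr x) = x.
Proof. by case: x => x hx; apply: eq_exist; rewrite /qrepr; case: cid. Qed.

Lemma qmulE u w : qmul (qclass u) (qclass w) = qclass (wmul u w).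
Proof. by apply/qclassP; apply: Ninv.1; apply/qclassP; apply: qreprK. Qed.

Lemma qmulA : associative qmul.
Proof.
move=> x y z; rewrite -(qreprK x) -(qreprK y) -(qreprK z) !qmulE.
congr qclass; apply: letters_inj; rewrite !letters_wmul; exact: catA.
Qed.

Definition qsemigroup : semigroup :=
  MkSemigroup qmulA (inhabits (qclass (letter 0))).

Lemma qeval (sigma : nat -> word) u :
  word_eval (S := qsemigroup) (qclass \o sigma) u = qclass (subst sigma u).
Proof.
elim/word_ind_rcons: u => [y|u y IHu]; first by rewrite subst_letter.
by rewrite word_eval_rcons IHu subst_wmul subst_letter /= qmulE.
Qed.

Lemma qsemigroupP u w : satisfies qsemigroup (u, w) <-> N u = N w.
Proof.
split=> [/(_ (qclass \o letter))|uw f].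
  by rewrite !qeval !subst_id => /qclassP.
have -> : f = qclass \o (qrepr \o f) by apply/funext=> y; rewrite /= qreprK.
by rewrite !qeval; apply/qclassP; apply: Ninv.2.
Qed.

Lemma theory_kvar u w : theory (kvar N) (u, w) <-> N u = N w.
Proof.
split=> [th|uw S]; last by apply.
by apply/qsemigroupP; apply: th => -[u' w'] /= /qsemigroupP.
Qed.

Lemma le_kvarP (V : variety) :
  (kvar N <= V)%O <-> forall u w, theory V (u, w) -> N u = N w.
Proof.
rewrite le_theoryP; split=> [h u w /h /theory_kvar //|h [u w] /h Nuw].
exact/theory_kvar.
Qed.

Lemma not_le_kvar (V : variety) :
  ~ (kvar N <= V)%O -> exists u w, theory V (u, w) /\ N u <> N w.
Proof.
move=> nV; apply: contrapT => no; apply: nV; apply/le_kvarP => u w Vuw.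
by apply: contrapT => Nuw; apply: no; exists u, w.
Qed.

End Kernel.

(** This presents the theory of [V] itself as a kernel. Its values are
    functions to [Prop], because [set] lives in a universe too large for
    [quotient]. *)
Definition theory_class (V : variety) (u : word) : word -> Prop :=
  fun w => theory V (u, w).

Lemma theory_classP (V : variety) u u' :
  theory_class V u = theory_class V u' <-> theory V (u, u').
Proof.
split=> [e|uu'].
  have : theory_class V u' u' by apply: theory_refl.
  by rewrite -e.
apply/funext => w; apply/propext; split; apply: theory_trans => //.
exact: theory_sym.
Qed.

Lemma theory_class_inv (V : variety) : fully_invariant (theory_class V).
Proof.
split=> [u u' w w' /theory_classP uu' /theory_classP ww'|
         sigma u w /theory_classP uw]; apply/theory_classP.
  exact: theory_mul.
exact: theory_subst.
Qed.

(** * Some varieties of bands, groups and null semigroups *)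

Definition first_letter (u : word) : nat := u.1.
Definition last_letter (u : word) : nat := last u.1 u.2.
(** The set of letters of [u], given by the predicates that hold somewhere on
    it. *)
Definition content (u : word) : (nat -> bool) -> bool :=
  fun A => has A (letters u).
(** Additive characters stand for the letter counts modulo [p]: they make
    invariance under substitution immediate, and the kernel is the theory of
    abelian groups of exponent dividing [p]. *)
Definition weight_mod (p : nat) (u : word) : (nat -> nat) -> nat :=
  fun f => (\sum_(y <- letters u) f y) %% p.
(** All words of length at least two are identified, as in null semigroups. *)
Definition single_letter (u : word) : option nat :=
  if u.2 is [::] then Some u.1 else None.

Notation LZ := (kvar first_letter).
Notation RZ := (kvar last_letter).
Notation SL := (kvar content).
Notation AB p := (kvar (weight_mod p)).
Notation ZM := (kvar single_letter).

Lemma subst_cons sigma u :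
  letters (subst sigma u) =
  letters (sigma u.1) ++ flatten [seq letters (sigma y) | y <- u.2].
Proof. by rewrite letters_subst. Qed.

Lemma size_subst sigma u : size (letters u) <= size (letters (subst sigma u)).
Proof.
rewrite letters_subst; elim: (letters u) => //= y s IHs.
by rewrite ltnS size_cat (leq_trans IHs) ?leq_addl.
Qed.

Lemma single_letterP u w :
  single_letter u = single_letter w <-> u = w \/ (u.2 != [::] /\ w.2 != [::]).
Proof.
case: u w => [a s] [b t]; rewrite /single_letter /=.
case: s t => [|c s] [|d t] /=; split=> //.
- by case=> ->; left.
- by case=> [[->]|[]].
- by case=> [|[]].
- by case=> [|[]].
- by right.
Qed.

Lemma tail_neq0 (u : word) : (u.2 != [::]) = (1 < size (letters u)).
Proof. by case: u => a []. Qed.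

Lemma first_letter_inv : fully_invariant first_letter.
Proof.
split=> [[a s] [b t] ? ? //|sigma [a s] [b t]].
by rewrite /first_letter /= => ->.
Qed.

Lemma last_lettersE u a : last_letter u = last a (letters u).
Proof. by []. Qed.

Lemma last_letter_inv : fully_invariant last_letter.
Proof.
split=> [u u' w w' _|sigma u w].
  by rewrite !(last_lettersE _ 0) !letters_wmul !last_cat.
have E v : last_letter (subst sigma v) = last_letter (sigma (last_letter v)).
  elim/word_ind_rcons: v => [y|v y _]; first by rewrite subst_letter.
  by rewrite subst_wmul subst_letter !(last_lettersE _ 0) !letters_wmul !last_cat.
by rewrite !E => ->.
Qed.

Lemma content_inv : fully_invariant content.
Proof.
split=> [u u' w w' uu' ww'|sigma u w uw]; apply/funext => A.
  rewrite /content !letters_wmul !has_cat.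
  by move: (congr1 (@^~ A) uu') (congr1 (@^~ A) ww'); rewrite /content => -> ->.
have E v : content (subst sigma v) A =
    content v (fun y => content (sigma y) A).
  rewrite /content letters_subst; elim: (letters v) => // y s IHs.
  by rewrite [LHS]has_cat IHs.
by rewrite !E uw.
Qed.

Lemma weight_mod_inv p : fully_invariant (weight_mod p).
Proof.
split=> [u u' w w' uu' ww'|sigma u w uw]; apply/funext => f.
  rewrite /weight_mod !letters_wmul !big_cat /= -modnDm -[RHS]modnDm.
  move: (congr1 (@^~ f) uu') (congr1 (@^~ f) ww').
  by rewrite /weight_mod => -> ->.
have E v : weight_mod p (subst sigma v) f =
    weight_mod p v (fun y => \sum_(z <- letters (sigma y)) f z).
  by rewrite /weight_mod letters_subst big_flatten big_map.
by rewrite !E uw.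
Qed.

Lemma single_letter_inv : fully_invariant single_letter.
Proof.
split=> [u u' w w' /single_letterP uu' /single_letterP ww'|
         sigma u w /single_letterP uw]; apply/single_letterP.
  by right; rewrite !tail_neq0 !letters_wmul !size_cat /= !addSn !addnS.
case: uw => [->|[]]; first by left.
rewrite !tail_neq0 => u1 w1; right.
by split; [apply: leq_trans u1 _|apply: leq_trans w1 _]; apply: size_subst.
Qed.

Definition trivial_variety (V : variety) : Prop :=
  forall W : variety, (V <= W)%O.

Lemma trivial_varietyP (V : variety) :
  trivial_variety V <-> forall S, members V S -> forall x y : S, x = y.
Proof.
split=> [tV S VS x y|tV W].
  have /le_theoryP/(_ (letter 0, letter 1)) := tV (kvar (fun=> tt)).
  have inv : fully_invariant (fun _ : word => tt) by [].
  case: (theory_kvar inv (letter 0) (letter 1)) => _ /(_ erefl) h /(_ h).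
  by move=> /(_ S VS (fun i => if i == 0 then x else y)).
by apply/le_membersP => S VS; apply/memP => e _ f; apply: (tV S VS).
Qed.

Lemma le_trivial (V W : variety) :
  (V <= W)%O -> trivial_variety W -> trivial_variety V.
Proof. by move=> VW tW U; apply: le_trans VW (tW U). Qed.

(** * Identities satisfied by powers *)

Definition power_identity (V : variety) (m n : nat) : Prop :=
  forall S, members V S -> forall s : unitized S, (s ^+ m = s ^+ n)%g.

Lemma prod_exp (M : monoidType) (s : M) (f : nat -> nat) (l : seq nat) :
  (\prod_(y <- l) s ^+ f y = s ^+ (\sum_(y <- l) f y))%g.
Proof.
elim: l => [|y l IHl]; first by rewrite !big_nil.
by rewrite !big_cons IHl expgnDr.
Qed.

Lemma theory_power (V : variety) u w (f : nat -> nat) :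
    theory V (u, w) -> (forall y, 0 < f y) ->
  power_identity V (\sum_(y <- letters u) f y) (\sum_(y <- letters w) f y).
Proof.
move=> Vuw f0 S VS s; have [->|/eqP s1] := eqVneq s 1%g.
  by rewrite !expg1n.
rewrite -!prod_exp; apply: satisfies_prod (Vuw S VS) _ => y.
exact: nonunit_exp.
Qed.

Lemma power_identityD (V : variety) m n k :
  power_identity V m n -> power_identity V (m + k) (n + k).
Proof. by move=> h S VS s; rewrite !expgnDr (h S VS). Qed.

Lemma power_period (V : variety) n d k :
  power_identity V n (n + d) -> power_identity V n (n + k * d).
Proof.
move=> h S VS s; elim: k => [|k IHk]; first by rewrite addn0.
rewrite mulSn addnA expgnDr -(h S VS) -expgnDr; exact: IHk.
Qed.

Lemma power_gcd (V : variety) n d d' : 0 < d ->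
  power_identity V n (n + d) -> power_identity V n (n + d') ->
  power_identity V n (n + gcdn d d').
Proof.
move=> d0 hd hd' S VS s; have [a b e _] := egcdnP d' d0.
have := power_identityD (gcdn d d') (power_period b hd').
rewrite -addnA -e => /(_ S VS s) ->.
exact: power_period a hd S VS s.
Qed.

(** Let d be the least period and p a prime divisor of d. An identity that fails
    in the groups of exponent p gives, on powers of one element, a period not
    divisible by p; its greatest common divisor with d is a smaller period. *)
Lemma aperiodic (V : variety) n d :
    0 < n -> 0 < d -> power_identity V n (n + d) ->
    (forall p, prime p -> ~ (AB p <= V)%O) ->
  exists2 m, 0 < m & power_identity V m m.+1.
Proof.
move=> n0; elim/ltn_ind: d n n0 => d IHd n n0 d0 hd nAB.
have [d1|d1] := leqP d 1.
  have d_eq1 : d = 1 by case: d d0 d1 {IHd hd} => [|[]].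
  by exists n => //; rewrite -addn1 -{1}d_eq1.
have p_pr := pdiv_prime d1; set p := pdiv d in p_pr.
have [u [w [Vuw]]] := not_le_kvar (weight_mod_inv p) (nAB _ p_pr).
move=> /eqP; rewrite /weight_mod => Nuw.
have {Nuw} [f fuw] : exists f : nat -> nat,
    \sum_(y <- letters u) f y != \sum_(y <- letters w) f y %[mod p].
  apply: contrapT => nf; case/eqP: Nuw; apply/funext => f.
  by apply/eqP/negP => /negP fuw; apply: nf; exists f.
(* Adding a multiple of d keeps the exponents modulo p, and makes them positive
   and large enough to lie in the periodic range. *)
pose F v := \sum_(y <- letters v) (f y + n * d).
have Fmod v : F v = \sum_(y <- letters v) f y %[mod p].
  rewrite /F big_split /= -modnDmr.
  suff -> : (\sum_(i <- letters v) n * d) %% p = 0 by rewrite addn0.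
  apply/eqP; rewrite big_const_seq iter_addn_0 -/(p %| _).
  by rewrite dvdn_mulr // dvdn_mull // pdiv_dvd.
have Fge v : n <= F v.
  rewrite /F big_cons (leq_trans _ (leq_addr _ _)) //.
  by rewrite (leq_trans _ (leq_addl _ _)) // leq_pmulr.
have step u' w' : theory V (u', w') -> F u' < F w' ->
    F u' != F w' %[mod p] -> exists2 m, 0 < m & power_identity V m m.+1.
  move=> th lt ne; pose d' := F w' - F u'.
  have d'E : F w' = F u' + d' by rewrite subnKC // ltnW.
  have hd' : power_identity V (F u') (F u' + d').
    by rewrite -d'E; apply: theory_power th _ => y; rewrite addn_gt0 muln_gt0 n0 d0 orbT.
  have hd2 : power_identity V (F u') (F u' + d).
    have := power_identityD (F u' - n) hd.
    by rewrite addnAC subnKC.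
  apply: (IHd (gcdn d d') _ (F u')).
  - rewrite ltn_neqAle dvdn_leq ?dvdn_gcdl // andbT.
    apply: contra ne => /eqP gd; rewrite d'E -[X in X == _ %[mod _]]addn0.
    rewrite eqn_modDl eq_sym mod0n; apply: (@dvdn_trans d).
      exact: pdiv_dvd.
    by rewrite -gd dvdn_gcdr.
  - exact: leq_trans n0 (Fge _).
  - by rewrite gcdn_gt0 d0.
  - exact: power_gcd.
  - exact: nAB.
have Fuw : F u != F w %[mod p] by rewrite !Fmod.
have [lt|lt|e] := ltngtP (F u) (F w); last by rewrite e eqxx in Fuw.
  exact: step Vuw lt Fuw.
by apply: step (theory_sym Vuw) lt _; rewrite eq_sym.
Qed.

Lemma power_stable (V : variety) n m k :
  power_identity V n n.+1 -> n <= m -> n <= k -> power_identity V m k.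
Proof.
rewrite -addn1 => h nm nk S VS s.
have E i : n <= i -> (s ^+ i = s ^+ n)%g.
  by move=> ni; rewrite -(subnKC ni) -[i - n]muln1 -(power_period (i - n) h VS s).
by rewrite !E.
Qed.

Lemma not_le_SL (V : variety) : ~ (SL <= V)%O ->
  exists u w (A : nat -> bool),
    [/\ theory V (u, w), has A (letters w) & ~~ has A (letters u)].
Proof.
case/(not_le_kvar content_inv) => u [w [Vuw Nuw]].
have [A] : exists A, content u A <> content w A.
  apply: contrapT => no; apply: Nuw; apply/funext => A.
  by apply: contrapT => ?; apply: no; exists A.
rewrite /content; case: (boolP (has A (letters u))) => hu;
  case: (boolP (has A (letters w))) => hw // _.
  by exists w, u, A; split=> //; apply: theory_sym.
by exists u, w, A.
Qed.

(** A letter that occurs on one side only can be sent to a power higher than the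
    total degree of the other side. *)
Lemma periodic_of_not_le_SL (V : variety) : ~ (SL <= V)%O ->
  exists n d, [/\ 0 < n, 0 < d & power_identity V n (n + d)].
Proof.
move=> /not_le_SL[u [w [A [Vuw hw hu]]]].
pose k := size (letters u); pose f y := if A y then k.+1 else 1.
have su : \sum_(y <- letters u) f y = k.
  rewrite (eq_big_seq (fun=> 1)) ?sum1_size // => y yu.
  by rewrite /f ifN //; apply: contra hu => Ay; apply/hasP; exists y.
have sw : k < \sum_(y <- letters w) f y.
  have /hasP[y yw Ay] := hw.
  by rewrite (big_rem y) //= {1}/f Ay leq_addr.
exists k, (\sum_(y <- letters w) f y - k); split; rewrite ?subn_gt0 //.
rewrite subnKC 1?ltnW // -{1}su; apply: theory_power Vuw _ => y.
by rewrite /f; case: ifP.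
Qed.

Section Idempotents.
Variables (V : variety) (S : semigroup).
Hypothesis VS : members V S.
Local Open Scope group_scope.
Implicit Types e f : unitized S.

(** In an identity whose sides have different contents, send the letters of a
    set met by one side only to efe, and the others to e. As e acts trivially
    on efe, the identity becomes e = (efe)^c with c > 0, and aperiodicity then
    gives efe = e. *)
Lemma sandwich_idempotent n e f : power_identity V n n.+1 -> ~ (SL <= V)%O ->
  nonunit e -> e * e = e -> e * f * e = e.
Proof.
move=> hn /not_le_SL[u [w [A [Vuw hw hu]]]] Pe ee.
have [h hE] : exists h, h = e * f * e by exists (e * f * e).
rewrite -hE.
have eh : e * h = h by rewrite hE !mulgA ee.
have he : h * e = h by rewrite hE -!mulgA ee.
have eX k : (0 < k)%N -> e ^+ k = e.
  by elim: k => // -[|k] IHk _ //; rewrite expgS IHk.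
pose g y := if A y then h else e.
have Pg y : nonunit (g y).
  by rewrite /g; case: ifP => // _; rewrite hE -mulgA; apply: nonunit_mulr.
have prodE l : \prod_(y <- l) g y * e = h ^+ count A l * e.
  elim: l => [|y l IHl]; first by rewrite big_nil.
  rewrite big_cons -mulgA IHl /g /=; case: (A y) => /=.
    by rewrite add1n expgS mulgA.
  rewrite add0n; case: (count A l) => [|c]; first by rewrite expg0 mul1g.
  by rewrite expgS !mulgA eh.
have hX k : (0 < k)%N -> h ^+ k * e = h ^+ k.
  by case: k => // k _; rewrite expgSr -mulgA he.
have ehc : e = h ^+ count A (letters w).
  rewrite -hX -?has_count // -prodE -(satisfies_prod (Vuw S VS) Pg) prodE.
  by move: hu; rewrite has_count -eqn0Ngt => /eqP ->; rewrite mul1g.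
have ehn : e = h ^+ n.
  case: (posnP n) => [n0|n0]; last first.
    rewrite -[LHS](eX n) // {1}ehc -expgnA.
    by apply: (power_stable hn) => //; rewrite leq_pmull // -has_count.
  have all1 x : x = 1 :> unitized S by rewrite -[x]expg1 -[in LHS]n0 -(hn S VS) n0.
  by rewrite (all1 e) (all1 (h ^+ n)).
by rewrite -eh {1}ehn -expgSr -(hn S VS).
Qed.

(** Once efe = e and fef = f, a product of factors e and f followed by e depends
    only on its first factor. *)
Lemma first_letter_idempotent e f : ~ (LZ <= V)%O -> nonunit e -> nonunit f ->
  e * e = e -> f * f = f -> e * f * e = e -> f * e * f = f -> e = f * e.
Proof.
move=> /(not_le_kvar first_letter_inv)[u [w [Vuw Nuw]]] Pe Pf ee ff efe fef.
pose g y := if y == first_letter u then e else f.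
have Pg y : nonunit (g y) by rewrite /g; case: ifP.
have main l : (e * (\prod_(y <- l) g y * e) = e)
           /\ (f * (\prod_(y <- l) g y * e) = f * e).
  elim: l => [|y l [IHe IHf]]; first by rewrite big_nil !mul1g.
  rewrite big_cons {1 3}/g -!mulgA; case: ifP => _; first by rewrite IHe ee.
  by rewrite IHf !mulgA efe ff.
have gu : g u.1 = e by rewrite /g eqxx.
have gw : g w.1 = f by rewrite /g ifN //; apply/eqP => /esym.
have := congr1 (fun x => x * e) (satisfies_prod (Vuw S VS) Pg).
rewrite !big_cons gu gw -!mulgA.
by rewrite (main u.2).1 (main w.2).2.
Qed.

Lemma last_letter_idempotent e f : ~ (RZ <= V)%O -> nonunit e -> nonunit f ->
  e * e = e -> f * f = f -> e * f * e = e -> f * e * f = f -> e = e * f.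
Proof.
move=> /(not_le_kvar last_letter_inv)[u [w [Vuw Nuw]]] Pe Pf ee ff efe fef.
pose g y := if y == last_letter u then e else f.
have Pg y : nonunit (g y) by rewrite /g; case: ifP.
have main l : (e * \prod_(y <- l) g y * e = e)
           /\ (e * \prod_(y <- l) g y * f = e * f).
  elim/last_ind: l => [|l y [IHe IHf]]; first by rewrite big_nil !mulg1.
  rewrite -cats1 big_cat big_seq1 {2 4}/g !mulgA; case: ifP => _.
    by rewrite IHe ee.
  by rewrite IHf efe -mulgA ff.
have gu : g (last_letter u) = e by rewrite /g eqxx.
have gw : g (last_letter w) = f by rewrite /g ifN //; apply/eqP => /esym.
have decomp v : exists l, letters v = rcons l (last_letter v).
  by exists (belast v.1 v.2); rewrite -lastI.
have [lu Eu] := decomp u; have [lw Ew] := decomp w.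
have := congr1 (fun x => e * x) (satisfies_prod (Vuw S VS) Pg).
rewrite Eu Ew -!cats1 !big_cat !big_seq1 gu gw /= !mulgA.
by rewrite (main lu).1 (main lw).2.
Qed.

End Idempotents.

(** * Nil-varieties *)

Definition absorbing (S : semigroup) (a : unitized S) : Prop :=
  forall t, (a * t = a /\ t * a = a)%g.

Definition nil_variety (V : variety) : Prop :=
  exists2 n, 0 < n & forall S, members V S -> forall s : unitized S,
    nonunit s -> absorbing (s ^+ n)%g.

Lemma power_idempotent (V : variety) S n (s : unitized S) :
  0 < n -> power_identity V n n.+1 -> members V S -> (s ^+ n * s ^+ n = s ^+ n)%g.
Proof.
by move=> n0 hn VS; rewrite -expgnDr; apply: (power_stable hn _ _ VS); rewrite ?leq_addr.
Qed.

(** Any two idempotents e and f satisfy efe = e and fef = f; identities that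
    change the first and the last letter then force e = f. A semigroup where all
    n-th powers are the same idempotent has this idempotent as its zero. *)
Lemma nil_of_not_le (V : variety) :
    ~ (SL <= V)%O -> ~ (LZ <= V)%O -> ~ (RZ <= V)%O ->
    (forall p, prime p -> ~ (AB p <= V)%O) ->
  nil_variety V.
Proof.
move=> nSL nLZ nRZ nAB.
have [a [d [a0 d0 had]]] := periodic_of_not_le_SL nSL.
have [n n0 hn] := aperiodic a0 d0 had nAB.
exists n => // S VS s Ps t.
have [->|/eqP Pt] := eqVneq t 1%g; first by rewrite mul1g mulg1.
have ss : (s ^+ n * s ^+ n = s ^+ n)%g by apply: power_idempotent hn VS.
have tt : (t ^+ n * t ^+ n = t ^+ n)%g by apply: power_idempotent hn VS.
have Psn := nonunit_exp n0 Ps; have Ptn := nonunit_exp n0 Pt.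
have sts := sandwich_idempotent VS (t ^+ n)%g hn nSL Psn ss.
have tst := sandwich_idempotent VS (s ^+ n)%g hn nSL Ptn tt.
have -> : (s ^+ n = t ^+ n)%g.
  rewrite (first_letter_idempotent VS nLZ Psn Ptn ss tt sts tst).
  by rewrite -(last_letter_idempotent VS nRZ Ptn Psn tt ss tst sts).
by rewrite -expgSr -expgS -(hn S VS).
Qed.

(** An identity that fails in null semigroups has a single letter on one
    side. *)
Lemma power_of_not_le_ZM (V : variety) :
  ~ (ZM <= V)%O -> exists2 m, 1 < m & power_identity V 1 m.
Proof.
move=> /(not_le_kvar single_letter_inv)[u [w [Vuw Nuw]]].
have step a v : theory V (letter a, v) -> letter a <> v ->
    exists2 m, 1 < m & power_identity V 1 m.
  move=> th av; have [v1|] := boolP (v.2 != [::]).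
    exists (size (letters v)); first by rewrite -tail_neq0.
    have := theory_power (f := fun=> 1) th (fun=> isT).
    by rewrite !sum1_size.
  case: v th av => b [|//] th ab _.
  exists 2 => //; have := theory_power (f := fun y => (y == b).+1) th (fun=> isT).
  rewrite !big_seq1 /= eqxx; case: eqP => // ab'.
  by case: ab; rewrite ab'.
have uw : u <> w by move=> e; case: Nuw; rewrite e.
have [u1|u1] := boolP (u.2 != [::]); last first.
  by case: u u1 uw Vuw {Nuw} => a [|//] _ uw Vuw; apply: step Vuw uw.
have [w1|w1] := boolP (w.2 != [::]).
  by case: Nuw; apply/single_letterP; right.
case: w w1 uw Vuw {Nuw} => b [|//] _ uw Vuw.
by apply: step (theory_sym Vuw) _ => /esym.
Qed.

(** Iterating x = x^m with m > 1 identifies x with powers of itself of large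
    degree, which are zero. *)
Lemma ZM_le_nil (V : variety) :
  nil_variety V -> ~ trivial_variety V -> (ZM <= V)%O.
Proof.
move=> [n n0 hn] ntV; apply: contrapT => /power_of_not_le_ZM[m m1 hm].
apply: ntV; apply/trivial_varietyP => S VS x y; apply: inj_unitized_inj.
have sn (s : unitized S) : nonunit s -> (s = s ^+ n)%g.
  move=> Ps; have m0 : 0 < m by apply: leq_trans m1.
  have h : power_identity V 1 (1 + (m - 1)) by rewrite subnKC.
  have := power_period n h VS s; rewrite expg1 => {1}->.
  have le : n <= 1 + n * (m - 1).
    by rewrite (leq_trans _ (leq_addl _ _)) // leq_pmulr // subn_gt0.
  by rewrite -(subnKC le) expgnDr (hn S VS s Ps _).1.
rewrite (sn _ (nonunit_inj x)) (sn _ (nonunit_inj y)).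
rewrite -(hn S VS _ (nonunit_inj x) (inj_unitized y ^+ n)%g).1.
by rewrite (hn S VS _ (nonunit_inj y) _).2.
Qed.

Lemma band_of_not_le (V : variety) :
    ~ (ZM <= V)%O -> (forall p, prime p -> ~ (AB p <= V)%O) ->
  power_identity V 1 2.
Proof.
move=> /power_of_not_le_ZM[m m1 hm] nAB.
have m0 : 0 < m by apply: leq_trans m1.
have h : power_identity V 1 (1 + (m - 1)) by rewrite subnKC.
have h0 : 0 < m - 1 by rewrite subn_gt0.
have [n n0 hn] := aperiodic (ltn0Sn 0) h0 h nAB.
have h1 := power_period n h.
have le : n <= 1 + n * (m - 1).
  by rewrite (leq_trans _ (leq_addl _ _)) // leq_pmulr.
move=> S VS s; rewrite (h1 S VS s).
rewrite (power_stable hn le (leq_trans le (leqnSn _)) VS s) expgSr -(h1 S VS s).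
by rewrite expg1 expg2.
Qed.

Lemma le_kvar_kvar X X' (N : word -> X) (N' : word -> X') u w :
  fully_invariant N -> (kvar N <= kvar N')%O -> N' u = N' w -> N u = N w.
Proof.
by move=> inv /(le_kvarP inv) h uw; apply: h => S; apply.
Qed.

Arguments le_kvar_kvar {X X' N N'} u w.

Lemma nontrivial_kvar X (N : word -> X) :
  fully_invariant N -> N (letter 0) <> N (letter 1) -> ~ trivial_variety (kvar N).
Proof.
move=> inv ne /(_ (kvar (fun=> tt))).
by move=> /(le_kvar_kvar (letter 0) (letter 1) inv) h; apply/ne/h.
Qed.

Lemma nontrivial_LZ : ~ trivial_variety LZ.
Proof. by apply: nontrivial_kvar first_letter_inv _. Qed.

Lemma nontrivial_RZ : ~ trivial_variety RZ.
Proof. by apply: nontrivial_kvar last_letter_inv _. Qed.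

Lemma nontrivial_SL : ~ trivial_variety SL.
Proof.
apply: nontrivial_kvar content_inv _.
by move=> /(congr1 (fun F => F (eq_op 0))).
Qed.

Lemma nontrivial_ZM : ~ trivial_variety ZM.
Proof. by apply: nontrivial_kvar single_letter_inv _ => -[]. Qed.

Lemma nontrivial_AB p : 1 < p -> ~ trivial_variety (AB p).
Proof.
move=> p1; apply: nontrivial_kvar (@weight_mod_inv p) _.
move=> /(congr1 (fun F => F id)); rewrite /weight_mod !big_seq1 mod0n modn_small //.
Qed.

(** * Lattice properties that single out null semigroups *)

(** For an atom [z], this says that V \/ z covers V or equals it. *)
Definition join_covered (z : variety) : Prop :=
  forall V U : variety, (V <= U)%O -> (U <= V `|` z)%O -> (U <= V)%O \/ (z <= U)%O.

(** [z] is the monolith of the subvariety lattice of a larger variety. *)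
Definition monolith_extends (z : variety) : Prop :=
  exists V : variety, [/\ (z <= V)%O, ~ (V <= z)%O &
    forall x : variety, (x <= V)%O -> trivial_variety x \/ (z <= x)%O].

Lemma theory_join (V W : variety) e :
  theory V e -> theory W e -> theory (V `|` W)%O e.
Proof. by move=> Ve We S; apply; split. Qed.

(** If U does not contain ZM, it satisfies x = x^m with m > 1. Replacing every
    letter by its m-th power turns an identity of V into one whose sides are
    long, which holds in V \/ ZM, hence in U; but in U this replacement changes
    nothing. *)
Lemma join_covered_ZM : join_covered ZM.
Proof.
move=> V U VU UVz; apply: contrapT => /not_orP[UV /power_of_not_le_ZM[m m1 hm]].
apply: UV; apply/le_theoryP => -[u w] Vuw S US.
pose sigma y : word := (y, nseq m.-1 y).
have ls y : letters (sigma y) = nseq m y by rewrite /letters /=; case: (m) m1.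
have long v : (subst sigma v).2 != [::].
  rewrite tail_neq0 subst_cons size_cat ls size_nseq.
  exact: leq_trans m1 (leq_addr _ _).
have Usig : theory U (subst sigma u, subst sigma w).
  move/le_theoryP: UVz; apply; apply: theory_join; first exact: theory_subst.
  by apply/(theory_kvar single_letter_inv)/single_letterP; right.
apply: prod_satisfies => g Pg.
have E v : (\prod_(y <- letters (subst sigma v)) g y =
            \prod_(y <- letters v) g y)%g.
  rewrite prod_subst; apply: eq_bigr => y _.
  rewrite ls -[RHS]expg1 (hm S US).
  by elim: (m) => [|k IHk]; rewrite ?big_nil // big_cons IHk expgS.
by rewrite -[LHS]E -[RHS]E; apply: satisfies_prod (Usig S US) Pg.
Qed.

(** * Semilattices, left and right zero semigroups *)

Section NotMonolith.
Variable V : variety.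
Hypothesis nZM : ~ (ZM <= V)%O.
Hypothesis nAB : forall p, prime p -> ~ (AB p <= V)%O.

Let band : power_identity V 1 2 := band_of_not_le nZM nAB.

Let idem S (s : unitized S) : members V S -> (s * s = s)%g.
Proof. by move=> VS; rewrite -expg2 -(band VS). Qed.

Lemma le_LZ_of_not_le :
  ~ (SL <= V)%O -> ~ (RZ <= V)%O -> (V <= LZ)%O.
Proof.
move=> nSL nRZ; apply/le_membersP => S VS [u w] /= uw.
apply: prod_satisfies => g Pg.
have ef e f : nonunit e -> nonunit f -> (e * f = e :> unitized S)%g.
  move=> Pe Pf; apply: esym.
  by apply: (last_letter_idempotent VS) => //; rewrite ?idem //;
     apply: (sandwich_idempotent VS) band nSL _ _; rewrite ?idem.
have E v : (\prod_(y <- letters v) g y = g (first_letter v))%g.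
  rewrite big_cons; elim: v.2 => [|y l IHl]; first by rewrite big_nil mulg1.
  by rewrite big_cons mulgA (ef _ _ (Pg _) (Pg _)).
by rewrite !E uw.
Qed.

Lemma le_RZ_of_not_le :
  ~ (SL <= V)%O -> ~ (LZ <= V)%O -> (V <= RZ)%O.
Proof.
move=> nSL nLZ; apply/le_membersP => S VS [u w] /= uw.
apply: prod_satisfies => g Pg.
have ef e f : nonunit e -> nonunit f -> (f * e = e :> unitized S)%g.
  move=> Pe Pf; apply: esym.
  by apply: (first_letter_idempotent VS) => //; rewrite ?idem //;
     apply: (sandwich_idempotent VS) band nSL _ _; rewrite ?idem.
have E v : (\prod_(y <- letters v) g y = g (last_letter v))%g.
  elim/word_ind_rcons: v => [y|v y IHv]; first by rewrite big_seq1.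
  rewrite letters_wmul big_cat big_seq1 IHv /= ef //; congr g.
  by rewrite !(last_lettersE _ 0) letters_wmul last_cat.
by rewrite !E uw.
Qed.

(** In a band, e = xy and f = yx satisfy efe = e and fef = f, so that xy = yx
    follows as in nil-varieties. *)
Lemma le_SL_of_not_le :
  ~ (LZ <= V)%O -> ~ (RZ <= V)%O -> (V <= SL)%O.
Proof.
move=> nLZ nRZ; apply/le_membersP => S VS [u w] /= uw.
have comm (e f : unitized S) : (e * f = f * e)%g.
  have [->|/eqP Pe] := eqVneq e 1%g; first by rewrite mul1g mulg1.
  have [->|/eqP Pf] := eqVneq f 1%g; first by rewrite mul1g mulg1.
  have Pef : nonunit (e * f)%g by apply: nonunit_mulr.
  have Pfe : nonunit (f * e)%g by apply: nonunit_mulr.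
  have sw (a b : unitized S) : (a * b * (b * a) * (a * b) = a * b)%g.
    by rewrite !mulgA -(mulgA a b b) idem // -(mulgA _ a a) idem // -mulgA idem.
  rewrite (first_letter_idempotent VS nLZ Pef Pfe) ?idem //.
  by rewrite -(last_letter_idempotent VS nRZ Pfe Pef) ?idem.
apply: prod_satisfies => g Pg.
have absorb (l : seq nat) y : y \in l ->
    (g y * \prod_(z <- l) g z = \prod_(z <- l) g z)%g.
  elim: l => // z l IHl; rewrite inE big_cons => /orP[/eqP ->|/IHl E].
    by rewrite mulgA idem.
  by rewrite mulgA [(g y * _)%g]comm -mulgA E.
have absorbs (l l' : seq nat) : {subset l' <= l} ->
    (\prod_(z <- l') g z * \prod_(z <- l) g z = \prod_(z <- l) g z)%g.
  elim: l' => [|z l' IHl'] sub; first by rewrite big_nil mul1g.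
  rewrite big_cons -mulgA IHl'.
    by apply: absorb; apply: sub; rewrite inE eqxx.
  by move=> y yl; apply: sub; rewrite inE yl orbT.
have uwi : letters u =i letters w.
  move=> y; rewrite -!has_pred1.
  exact: (congr1 (fun F => F (pred1 y : nat -> bool)) uw).
rewrite -(absorbs _ (letters w)); last by move=> y; rewrite uwi.
by rewrite comm; apply: absorbs => y; rewrite uwi.
Qed.

End NotMonolith.

Lemma AB_comm p : weight_mod p (0, [:: 1]) = weight_mod p (1, [:: 0]).
Proof.
by apply/funext => f; rewrite /weight_mod !big_cons !big_nil !addn0 addnC.
Qed.

Lemma content_comm : content (0, [:: 1]) = content (1, [:: 0]).
Proof. by apply/funext => A; rewrite /content /= !orbF orbC. Qed.

Lemma not_monolith_LZ : ~ monolith_extends LZ.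
Proof.
move=> [V [_ VLZ mono]]; apply: VLZ.
have LZinv := first_letter_inv.
apply: le_LZ_of_not_le => [/mono[/nontrivial_ZM|]|p pp /mono[|]|
    /mono[/nontrivial_SL|]|/mono[/nontrivial_RZ|]] //.
- by move=> /(le_kvar_kvar (0, [:: 1]) (1, [:: 0]) LZinv)/(_ erefl).
- exact/nontrivial_AB/prime_gt1.
- by move=> /(le_kvar_kvar (0, [:: 1]) (1, [:: 0]) LZinv)/(_ (AB_comm p)).
- by move=> /(le_kvar_kvar (0, [:: 1]) (1, [:: 0]) LZinv)/(_ content_comm).
- by move=> /(le_kvar_kvar (1, [:: 0]) (letter 0) LZinv)/(_ erefl).
Qed.

Lemma not_monolith_RZ : ~ monolith_extends RZ.
Proof.
move=> [V [_ VRZ mono]]; apply: VRZ.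
have RZinv := last_letter_inv.
apply: le_RZ_of_not_le => [/mono[/nontrivial_ZM|]|p pp /mono[|]|
    /mono[/nontrivial_SL|]|/mono[/nontrivial_LZ|]] //.
- by move=> /(le_kvar_kvar (0, [:: 1]) (1, [:: 0]) RZinv)/(_ erefl).
- exact/nontrivial_AB/prime_gt1.
- by move=> /(le_kvar_kvar (0, [:: 1]) (1, [:: 0]) RZinv)/(_ (AB_comm p)).
- by move=> /(le_kvar_kvar (0, [:: 1]) (1, [:: 0]) RZinv)/(_ content_comm).
- by move=> /(le_kvar_kvar (0, [:: 1]) (letter 0) RZinv)/(_ erefl).
Qed.

Lemma not_monolith_SL : ~ monolith_extends SL.
Proof.
move=> [V [_ VSL mono]]; apply: VSL.
have SLinv := content_inv.
have ne u w X (N : word -> X) : (SL <= kvar N)%O -> N u = N w ->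
    has (eq_op 1) (letters u) = has (eq_op 1) (letters w).
  by move=> /(le_kvar_kvar u w SLinv) h /h /(congr1 (fun F => F (eq_op 1))).
apply: le_SL_of_not_le => [/mono[/nontrivial_ZM|]|p pp /mono[|]|
    /mono[/nontrivial_LZ|]|/mono[/nontrivial_RZ|]] //.
- by move=> /(ne (0, [:: 1]) (0, [:: 0]))/(_ erefl).
- exact/nontrivial_AB/prime_gt1.
- move=> /(ne (0, nseq p 1) (letter 0)) h.
  have : weight_mod p (0, nseq p 1) = weight_mod p (letter 0).
    apply/funext => f; rewrite /weight_mod !big_cons big_nil addn0.
    by rewrite big_nseq iter_addn_0 addnC modnMDl.
  by move=> /h; case: (p) pp.
- by move=> /(ne (0, [:: 1]) (letter 0))/(_ erefl).
- by move=> /(ne (1, [:: 0]) (letter 0))/(_ erefl).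
Qed.

(** * Abelian groups of prime exponent *)

(** The theory of xyzt = 0. *)
Definition trunc4 (u : word) : option word :=
  if 3 < size (letters u) then None else Some u.

Definition swap_square (u : word) : word :=
  if u.2 is [:: b; c] then if u.1 == b then (u.1, [:: c; c]) else u else u.

(** The theory of xyzt = 0 and xxy = xyy. *)
Definition trunc4_swap (u : word) : option word :=
  if 3 < size (letters u) then None else Some (swap_square u).

Lemma size_wmul u w :
  size (letters (wmul u w)) = size (letters u) + size (letters w).
Proof. by rewrite letters_wmul size_cat. Qed.

Lemma size_letters_gt0 u : 0 < size (letters u). Proof. by []. Qed.

Lemma size_swap_square u : size (letters (swap_square u)) = size (letters u).
Proof. by case: u => a [|b [|c [|d l]]] //; rewrite /swap_square /=; case: ifP. Qed.

Lemma swap_square_small u : size (letters u) < 3 -> swap_square u = u.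
Proof. by case: u => a [|b [|c [|d l]]]. Qed.

Lemma trunc4_inv : fully_invariant trunc4.
Proof.
rewrite /trunc4; split=> [u u' w w'|sigma u w].
  rewrite !size_wmul; case: ltnP => u4; case: ltnP => u4' //.
    by rewrite !(leq_trans _ (leq_addr _ _)).
  move=> [->]; case: ltnP => w4; case: ltnP => w4' //.
    by rewrite !(leq_trans _ (leq_addl _ _)).
  by move=> [->].
case: ltnP => u4; case: ltnP => w4 //; last by move=> [->].
by rewrite !(leq_trans _ (size_subst _ _)).
Qed.

Lemma trunc4_swap_size u w : size (letters u) <= 3 ->
  trunc4_swap u = trunc4_swap w -> size (letters u) = size (letters w).
Proof.
rewrite /trunc4_swap leqNgt => /negbTE ->; case: ifP => // _ [e].
by rewrite -size_swap_square e size_swap_square.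
Qed.

Lemma trunc4_swap_small u w :
  size (letters u) < 3 -> trunc4_swap u = trunc4_swap w -> u = w.
Proof.
move=> u3 uw; have u4 := ltnW u3.
have su := trunc4_swap_size u4 uw; move: uw.
by rewrite /trunc4_swap -su (leq_gtF u4) !swap_square_small -?su // => -[].
Qed.

Lemma trunc4_swap_inv : fully_invariant trunc4_swap.
Proof.
split=> [u u' w w' uu' ww'|sigma u w].
  have [u4|u4] := leqP (size (letters u)) 3; last first.
    have u4' : 3 < size (letters u').
      by move: uu'; rewrite /trunc4_swap u4; case: ifP.
    by rewrite /trunc4_swap !size_wmul !(leq_trans _ (leq_addr _ _)).
  have [w4|w4] := leqP (size (letters w)) 3; last first.
    have w4' : 3 < size (letters w').
      by move: ww'; rewrite /trunc4_swap w4; case: ifP.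
    by rewrite /trunc4_swap !size_wmul !(leq_trans _ (leq_addl _ _)).
  have su := trunc4_swap_size u4 uu'; have sw := trunc4_swap_size w4 ww'.
  have [l|l] := ltnP 3 (size (letters u) + size (letters w)).
    by rewrite /trunc4_swap !size_wmul l -su -sw l.
  have u3 : size (letters u) < 3.
    by apply: leq_trans l; rewrite -addn1 leq_add2l.
  have w3 : size (letters w) < 3.
    by apply: leq_trans l; rewrite -add1n leq_add2r.
  by rewrite (trunc4_swap_small u3 uu') (trunc4_swap_small w3 ww').
have size3 a b c : size (letters (subst sigma (a, [:: b; c]))) =
    size (letters (sigma a)) + (size (letters (sigma b)) + size (letters (sigma c))).
  by rewrite letters_subst -2!size_cat -[in RHS](cats0 (letters (sigma c))).
have swapE v : trunc4_swap (subst sigma (swap_square v)) =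
               trunc4_swap (subst sigma v).
  case: v => a [|b [|c [|d l]]] //=; rewrite /swap_square /=.
  case: eqP => // <- {b}.
  have sa := size_letters_gt0 (sigma a); have sc := size_letters_gt0 (sigma c).
  have None_of x y : 0 < x -> 0 < y -> 1 < maxn x y ->
      (3 < x + (y + y)) && (3 < x + (x + y)).
    by case: x y => [|[|x]] [|[|y]] // _ _ _; rewrite !(addnS, addSn).
  have [big|] := ltnP 1 (maxn (size (letters (sigma a))) (size (letters (sigma c)))).
    by have /andP[l r] := None_of _ _ sa sc big; rewrite /trunc4_swap !size3 l r.
  rewrite geq_max /trunc4_swap /subst /=.
  case: (sigma a) (sigma c) => a' [|//] [c' [|//]] _ /=.
  by rewrite /swap_square /= eqxx; case: eqP => [<-|].
have [u4|u4] := leqP (size (letters u)) 3; last first.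
  rewrite {1 2}/trunc4_swap u4; case: ifP => // w4 _.
  by rewrite /trunc4_swap !(leq_trans _ (size_subst _ _)).
move=> uw; rewrite -swapE -[RHS]swapE.
suff -> : swap_square u = swap_square w by [].
have su := trunc4_swap_size u4 uw; move: uw.
by rewrite /trunc4_swap -su (leq_gtF u4) => -[].
Qed.

(** The only nontrivial identity xxy = xyy between short words has different
    letter counts modulo any p > 1, hence is lost in the join with the groups of
    exponent p. *)
Lemma trunc4_of_swap p u w : 1 < p -> trunc4_swap u = trunc4_swap w ->
  weight_mod p u = weight_mod p w -> trunc4 u = trunc4 w.
Proof.
move=> p1 uw; have [u4|u4] := leqP (size (letters u)) 3; last first.
  by move: uw; rewrite /trunc4_swap /trunc4 u4; case: ifP.
have su := trunc4_swap_size u4 uw.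
move: uw; rewrite /trunc4_swap /trunc4 -su (leq_gtF u4) => -[uw] wuw; congr Some.
have [u3|u3] := ltnP (size (letters u)) 3.
  by move: uw; rewrite !swap_square_small -?su.
have unbalanced a b : a <> b ->
    weight_mod p (a, [:: a; b]) <> weight_mod p (a, [:: b; b]).
  move=> /eqP/negbTE ab /(congr1 (fun F => F (fun y => (y == a) : nat))).
  rewrite /weight_mod !big_cons !big_nil /= eqxx (eq_sym b) ab.
  by move/eqP; rewrite (eqn_modDl 1 1 0) mod0n modn_small.
have form (v : word) : 2 < size (letters v) <= 3 -> exists a b c, v = (a, [:: b; c]).
  by case: v => a [|b [|c [|d l]]] // _; exists a, b, c.
have [a [b [c uE]]] : exists a b c, u = (a, [:: b; c]) by apply: form; rewrite u3.
have [a' [b' [c' wE]]] : exists a b c, w = (a, [:: b; c]).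
  by apply: form; rewrite -su u3.
move: uw wuw; rewrite {}uE {}wE /swap_square /=.
case: eqP => [<-|ab]; case: eqP => [<-|ab'] [].
- by move=> -> ->.
- move=> aa cb cc; subst a' b' c'; move=> h; have [ac|/unbalanced //] := pselect (a = c).
  by rewrite ac.
- move=> aa bc cc; subst a' b c'; move=> h; have [ac|/unbalanced] := pselect (a = c).
    by rewrite ac.
  by move/(_ (esym h)).
- by move=> -> -> ->.
Qed.

(** The variety xyzt = 0 lies strictly between its subvariety given by xxy = xyy
    and the join of the latter with the groups of exponent p. *)
Lemma not_join_covered_AB p : prime p -> ~ join_covered (AB p).
Proof.
move=> /prime_gt1 p1 /(_ (kvar trunc4_swap) (kvar trunc4)) [].
- apply/(le_kvarP trunc4_swap_inv) => u w /(theory_kvar trunc4_inv).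
  by rewrite /trunc4 /trunc4_swap; case: ifP; case: ifP => // _ _ [->].
- apply/(le_kvarP trunc4_inv) => u w J; apply: (trunc4_of_swap p1).
    apply/(theory_kvar trunc4_swap_inv).
    by have /le_theoryP := leUl (kvar trunc4_swap) (AB p); apply.
  apply/(theory_kvar (@weight_mod_inv p)).
  by have /le_theoryP := leUr (AB p) (kvar trunc4_swap); apply.
- move=> /(le_kvar_kvar (0, [:: 0; 1]) (0, [:: 1; 1]) trunc4_inv).
  by move/(_ erefl).
- move=> /(le_kvar_kvar (0, nseq 3 0) (0, nseq 4 0) (@weight_mod_inv p)).
  move/(_ erefl)/(congr1 (fun F => F (fun=> 1))).
  rewrite /weight_mod !big_cons !big_nil => /eqP.
  by rewrite (eqn_modDl 4 0 1) mod0n modn_small.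
Qed.

Lemma monolith_extends_contains z x : monolith_extends z ->
  (x <= z)%O -> ~ trivial_variety x -> (z <= x)%O.
Proof.
by move=> [V [zV _ mono]] xz nx; case: (mono x (le_trans xz zV)).
Qed.

Definition zm_like (z : variety) : Prop :=
  [/\ ~ trivial_variety z, join_covered z & monolith_extends z].

(** The second half of the definition makes [z] the least of its nontrivial
    subvarieties, so [z] equals any of the named varieties that it contains. *)
Lemma zm_like_ZM z : zm_like z -> z = ZM.
Proof.
move=> [ntz jz mz].
have minimal x : (x <= z)%O -> ~ trivial_variety x -> z = x.
  by move=> xz nx; apply/le_anti; rewrite xz (monolith_extends_contains mz xz nx).
have [/minimal/(_ nontrivial_SL) e|nSL] := pselect (SL <= z)%O.
  by case: not_monolith_SL; rewrite -e.
have [/minimal/(_ nontrivial_LZ) e|nLZ] := pselect (LZ <= z)%O.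
  by case: not_monolith_LZ; rewrite -e.
have [/minimal/(_ nontrivial_RZ) e|nRZ] := pselect (RZ <= z)%O.
  by case: not_monolith_RZ; rewrite -e.
have nAB p : prime p -> ~ (AB p <= z)%O.
  move=> pp /minimal/(_ (nontrivial_AB (prime_gt1 pp))) e.
  by case: (not_join_covered_AB pp); rewrite -e.
apply: minimal nontrivial_ZM; apply: ZM_le_nil ntz; exact: nil_of_not_le.
Qed.

Lemma nil_le (V W : variety) : (V <= W)%O -> nil_variety W -> nil_variety V.
Proof.
by move=> /le_membersP VW [n n0 hn]; exists n => // S /VW WS; apply: hn.
Qed.

Lemma nil_varietyP (V : variety) : nil_variety V <->
  forall x : variety, (x <= V)%O -> trivial_variety x \/ (ZM <= x)%O.
Proof.
split=> [nV x /nil_le/(_ nV) nx|mono].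
  by have [|nt] := pselect (trivial_variety x); [left|right; apply: ZM_le_nil].
have no X (N : word -> X) u w : single_letter u <> single_letter w ->
    N u = N w -> ~ trivial_variety (kvar N) -> ~ (kvar N <= V)%O.
  move=> ne uw nt /mono[//|] /(le_kvar_kvar u w single_letter_inv) h.
  exact/ne/h.
apply: nil_of_not_le.
- apply: (no _ _ (letter 0) (0, [:: 0])) nontrivial_SL => //.
  by apply/funext => A; rewrite /content /=; case: (A 0).
- exact: (no _ _ (letter 0) (0, [:: 1])) nontrivial_LZ.
- exact: (no _ _ (letter 0) (1, [:: 0])) nontrivial_RZ.
- move=> p pp; apply: (no _ _ (letter 0) (0, nseq p 0)); last first.
  + exact/nontrivial_AB/prime_gt1.
  + apply/funext => f; rewrite /weight_mod !big_cons big_nil addn0 big_nseq.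
    by rewrite iter_addn_0 addnC modnMDl.
  + by case: (p) pp.
Qed.

(** * Nil-semigroups with a linear word equal to a longer one *)

Lemma sum_lt_of_subset (F : nat -> nat) (l m : seq nat) :
    (forall y, 0 < F y) -> uniq l -> {subset l <= m} -> size l < size m ->
  \sum_(y <- l) F y < \sum_(y <- m) F y.
Proof.
move=> F0; elim: l m => [|a l IHl] m /=.
  by case: m => // b m _ _ _; rewrite big_nil big_cons addn_gt0 F0.
move=> /andP[al ul] sub sz; have am : a \in m by apply: sub; rewrite inE eqxx.
rewrite big_cons (perm_big _ (perm_to_rem am)) big_cons ltn_add2l /=.
apply: IHl => // [y yl|]; last by rewrite size_rem // -ltnS prednK // (leq_trans _ sz).
have := sub y; rewrite inE yl orbT => /(_ isT).
rewrite (perm_mem (perm_to_rem am)) inE => /orP[/eqP ya|//].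
by rewrite -ya yl in al.
Qed.

(** A word at least as long as the linear word [l] is a substitution instance of
    it. *)
Lemma split_blocks (l t : seq nat) : uniq l -> 0 < size l <= size t ->
  exists sigma : nat -> seq nat,
    (forall y, 0 < size (sigma y)) /\ flatten [seq sigma y | y <- l] = t.
Proof.
elim: l t => // a [|a' l] IHl t /andP[al ul] sz.
  by exists (fun=> t); rewrite /= cats0.
case: t sz => // b t sz; have [|sigma [pos E]] := IHl t ul; first by [].
exists (fun y => if y == a then [:: b] else sigma y); split=> [y|].
  by case: ifP.
have mapE : [seq if y == a then [:: b] else sigma y | y <- a' :: l] =
    [seq sigma y | y <- a' :: l].
  by apply/eq_in_map => y yl; case: eqP => // ya; rewrite -ya yl in al.
by rewrite map_cons eqxx mapE; exact: (congr1 (cons b) E).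
Qed.

Lemma first_mismatch (l m : seq nat) : size l < size m ->
  (exists2 m', m' != [::] & m = l ++ m') \/
  (exists l1 a l2 b m2, [/\ l = l1 ++ a :: l2, m = l1 ++ b :: m2 & a <> b]).
Proof.
elim: l m => [|a l IHl] [|b m] //= sz; first by left; exists (b :: m).
have [->|ab] := pselect (a = b); last by right; exists [::], a, l, b, m.
case: (IHl m sz) => [[m' m0 ->]|[l1 [c [l2 [d [m2 [-> -> cd]]]]]]].
  by left; exists m'.
by right; exists (b :: l1), c, l2, d, m2.
Qed.

Lemma index_iota_prefix (l l1 l2 : seq nat) : uniq l -> l = l1 ++ l2 ->
  [seq index y l | y <- l1] = iota 0 (size l1).
Proof.
move=> ul lE; apply: (@eq_from_nth _ 0); first by rewrite size_map size_iota.
move=> i; rewrite size_map => il; rewrite (nth_map 0) // nth_iota //.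
rewrite -[RHS](@index_uniq _ 0 i l) //; last by rewrite lE size_cat ltn_addr.
by rewrite [in nth 0 l]lE nth_cat il.
Qed.

Lemma limsup_exists (om : nat -> nat) B : (forall m, om m <= B) ->
  exists b, (exists M, forall m, M <= m -> om m <= b) /\
            (forall M, exists2 m, M <= m & om m = b).
Proof.
move=> omB; have : exists M, forall m, M <= m -> om m <= B by exists 0.
elim: B {omB} => [|B IHB] evB.
  exists 0; split=> // M; case: evB => M' h; exists (maxn M M').
    exact: leq_maxl.
  by apply/eqP; rewrite -leqn0; apply: h; apply: leq_maxr.
have [io|] := pselect (forall M, exists2 m, M <= m & om m = B.+1).
  by exists B.+1.
move/existsNP => [M nM]; apply: IHB; case: evB => M' h; exists (maxn M M') => m.
rewrite geq_max => /andP[Mm M'm]; rewrite -ltnS ltn_neqAle (h m M'm) andbT.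
by apply/eqP => e; apply: nM; exists m.
Qed.

Lemma increasing_choice (P : nat -> nat -> Prop) :
    (forall a M, exists2 m, M < m & P a m) ->
  exists p : nat -> nat, forall a, P a (p a) /\ p a < p a.+1.
Proof.
move=> inf; have /choice[nx nxP] : forall aM : nat * nat, exists m, aM.2 < m /\ P aM.1 m.
  by move=> [a M]; have [m] := inf a M; exists m.
pose p := fix p a := if a is a'.+1 then nx (a, p a') else nx (0, 0).
exists p => a; split; last exact: (nxP (a.+1, p a)).1.
case: a => [|a]; [exact: (nxP (0, 0)).2|exact: (nxP (a.+1, p a)).2].
Qed.

Section LongerIdentity.
Variables (S : semigroup) (n : nat) (u w : word) (f : nat -> unitized S).
Hypothesis nilS : forall s : unitized S, nonunit s -> absorbing (s ^+ n)%g.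
Hypothesis Suw : satisfies S (u, w).
Hypothesis uniq_u : uniq (letters u).
Hypothesis sub_uw : {subset letters u <= letters w}.
Hypothesis sub_wu : {subset letters w <= letters u}.
Hypothesis size_uw : size (letters u) < size (letters w).
Hypothesis Pf : forall y, nonunit (f y).

Local Notation l := (letters u).
Local Notation m := (letters w).
Let ev (t : seq nat) : unitized S := (\prod_(y <- t) f y)%g.
Let s := ev l.

Let ev_cat t t' : ev (t ++ t') = (ev t * ev t')%g.
Proof. by rewrite /ev big_cat. Qed.

Let ev_nonunit t : 0 < size t -> nonunit (ev t).
Proof. by case: t => // a t _; rewrite /ev big_cons; apply: nonunit_mulr. Qed.

Let ev_blocks (sigma : nat -> seq nat) : (forall y, 0 < size (sigma y)) ->
  ev (flatten [seq sigma y | y <- l]) = ev (flatten [seq sigma y | y <- m]).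
Proof.
move=> pos; have E t : ev (flatten [seq sigma y | y <- t]) =
    (\prod_(y <- t) ev (sigma y))%g by rewrite /ev big_flatten big_map.
by rewrite !E; apply: satisfies_prod Suw _ => y; apply: ev_nonunit.
Qed.

(** A prefix is good if arbitrarily long words with this prefix have the same
    value as [u]. Such words exist because applying the identity to a word makes
    it longer. *)
Let good (t : seq nat) : Prop := forall N, exists q,
  [/\ N <= size q, {subset t ++ q <= l} & ev (t ++ q) = s].

Let flatten_sub (sigma : nat -> seq nat) (t : seq nat) :
    {subset t <= l} -> {subset flatten [seq sigma y | y <- l] <= l} ->
  {subset flatten [seq sigma y | y <- t] <= l}.
Proof.
move=> tl sl z /flattenP[_ /mapP[y yt ->] zy]; apply: sl.
by apply/flattenP; exists (sigma y) => //; apply: map_f; apply: tl.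
Qed.

Let good_nil : good [::].
Proof.
move=> N; have [q [sz ql qs]] : exists q,
    [/\ N + size l <= size q, {subset q <= l} & ev q = s].
  elim: N => [|N [q [sz ql qs]]]; first by exists l; split; rewrite ?add0n.
  have [|sigma [pos E]] := @split_blocks l q uniq_u.
    by apply/andP; split=> //; apply: leq_trans sz; apply: leq_addl.
  exists (flatten [seq sigma y | y <- m]); split; last by rewrite -ev_blocks ?E.
    rewrite addSn (leq_ltn_trans sz) // -E !size_flatten !sumnE !big_map.
    exact: sum_lt_of_subset.
  by apply: flatten_sub; rewrite ?E.
by exists q; split=> //; apply: leq_trans sz; apply: leq_addr.
Qed.

Let good_letter t c : good (rcons t c) -> c \in l.
Proof.
move=> /(_ 0)[q [_ sub _]]; apply: sub.
by rewrite mem_cat mem_rcons inE eqxx.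
Qed.

Let good_rcons t : good t -> exists c, good (rcons t c).
Proof.
move=> gt; apply: contrapT => no.
have /choice[B hB] : forall c, exists N, forall q, N <= size q ->
    {subset rcons t c ++ q <= l} -> ev (rcons t c ++ q) <> s.
  move=> c; apply: contrapT => noN; apply: no; exists c => N.
  apply: contrapT => noq; apply: noN; exists N => q Nq sub evq.
  by apply: noq; exists q.
have [q [sz sub evq]] := gt (\max_(c <- l) B c).+1.
case: q sz sub evq => // c q; rewrite /= ltnS -cat_rcons => sz sub.
apply: hB => //; apply: leq_trans sz; apply: leq_bigmax_seq => //.
by apply: sub; rewrite mem_cat mem_rcons inE eqxx.
Qed.

Let best (t : seq nat) (c : nat) : Prop :=
  good (rcons t c) /\ forall c', good (rcons t c') -> c' <= c.

Let bound := \max_(c <- l) c.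

Let good_best t : good t -> exists c, best t c.
Proof.
move=> /good_rcons[c0 g0]; pose P c := `[< good (rcons t c) >].
have exP : exists c, P c by exists c0; apply/asboolP.
have ubP c : P c -> c <= bound.
  by move=> /asboolP/good_letter cl; apply: (leq_bigmax_seq (F := id)).
have [c /asboolP gc cmax] := ex_maxnP exP ubP.
by exists c; split=> // c' gc'; apply: cmax; apply/asboolP.
Qed.

(** The lexicographically greatest infinite word all of whose prefixes are
    good. *)
Let limit_word : exists om : nat -> nat, forall i,
  good (mkseq om i) /\ best (mkseq om i) (om i).
Proof.
have /choice[nx nxP] : forall t, exists c, good t -> best t c.
  move=> t; have [/good_best[c bc]|ng] := pselect (good t); first by exists c.
  by exists 0.
pose W i := iter i (fun t => rcons t (nx t)) [::].
have WE i : mkseq (nx \o W) i = W i by elim: i => // i IHi; rewrite mkseqS IHi.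
exists (nx \o W) => i; rewrite WE.
suff gW : good (W i) by split=> //; apply: nxP.
by elim: i => [|i IHi]; [exact: good_nil|exact: (nxP _ IHi).1].
Qed.

(** Let c be the upper limit of the letters of the lexicographically greatest
    limit word. If the word is eventually constant, a high power of c makes the
    value zero. Otherwise it can be cut into blocks so that exactly one chosen
    block starts below c and the others start with c. Let the chosen block stand
    for the letter of u at the first place where u and w differ: applying the
    identity puts at this place a block that starts with c, and produces a good
    prefix that is greater. If u is a prefix of w, then the value s of u
    satisfies s = st for some t, and s = st^n is zero. *)
Lemma absorbing_of_longer : absorbing s.
Proof.
have factor t : absorbing t -> forall a b, s = (a * t * b)%g -> absorbing s.
  by move=> at_ a b ->; rewrite (at_ a).2 (at_ b).1.
case: (first_mismatch size_uw) => [[m' m0 mE]|[l1 [a [l2 [b [m2 [lE mE ab]]]]]]].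
  have Pm' : nonunit (ev m') by apply: ev_nonunit; case: (m') m0.
  have ss : s = (s * ev m')%g.
    by rewrite -ev_cat -mE; apply: satisfies_prod Suw _.
  have sn : s = (s * ev m' ^+ n)%g.
    by elim: n => [|k IHk]; [rewrite mulg1|rewrite expgSr mulgA -IHk].
  by apply: (factor _ (nilS Pm') s 1%g); rewrite mulg1.
have [om omP] := limit_word.
have om_l i : om i \in l by apply: good_letter; exact: (omP i).2.1.
have om_bound i : om i <= bound.
  exact: (leq_bigmax_seq (F := id)).
have [c [[M0 om_le] om_c]] := limsup_exists om_bound.
have [lt_c|] := pselect (forall M, exists2 i, M <= i & om i < c); last first.
  move/existsNP => [M1 ev_c]; pose M := maxn M0 M1.
  have omE i : M <= i -> om i = c.
    rewrite geq_max => /andP[M0i M1i]; apply/eqP; rewrite eqn_leq om_le //=.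
    by rewrite leqNgt; apply/negP => lt; apply: ev_c; exists i.
  have [q [_ _]] := (omP (M + n)).1 0.
  rewrite ev_cat /mkseq iotaD map_cat ev_cat => e.
  apply: (factor _ (nilS (@Pf c)) (ev [seq om i | i <- iota 0 M]) (ev q)).
  rewrite -e; congr (_ * _ * _)%g; rewrite /ev big_map add0n.
  rewrite (eq_big_seq (fun=> f c)) => [|i]; last first.
    by rewrite mem_iota => /andP[/omE -> _].
  rewrite big_const_seq count_predT size_iota.
  by elim: n => // k IHk; rewrite expgS /= IHk.
exfalso.
(* Only the block of index [size l1], at the mismatch, starts below c. *)
pose P i j : Prop := if i == size l1 then is_true (om j < c) else om j = c.
have [|p pP] := @increasing_choice P.
  move=> i M; rewrite /P; case: (i == size l1); first exact: lt_c M.+1.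
  exact: om_c M.+1.
pose block i := [seq om j | j <- iota (p i) (p i.+1 - p i)].
pose sigma y := block (index y l).
have pos y : 0 < size (sigma y).
  by rewrite size_map size_iota subn_gt0 (pP _).2.
have blocks i : mkseq om (p 0) ++ flatten [seq block j | j <- iota 0 i] = mkseq om (p i).
  elim: i => [|i IHi]; first by rewrite cats0.
  rewrite -addn1 iotaD map_cat flatten_cat catA IHi /= cats0 addn1.
  rewrite /mkseq -[in RHS](subnKC (ltnW (pP i).2)) iotaD map_cat.
  by rewrite add0n.
have prefix l' l'' : l = l' ++ l'' ->
    mkseq om (p 0) ++ flatten [seq sigma y | y <- l'] = mkseq om (p (size l')).
  move=> E; rewrite -(blocks (size l')) -(index_iota_prefix uniq_u E) -map_comp.
  by [].
have bl : b \in l by apply: sub_wu; rewrite mE mem_cat inE eqxx orbT.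
have ib : index b l != size l1.
  apply/eqP => e; apply: ab; rewrite -(nth_index 0 bl) e lE.
  by rewrite nth_cat ltnn subnn.
have [rest sb] : exists rest, sigma b = c :: rest.
  have := (pP (index b l)).1; rewrite /P (negbTE ib) => omc.
  have := (pP (index b l)).2; rewrite -subn_gt0 /sigma /block.
  by case: (_ - _) => // d _; rewrite /= omc; eexists.
have om_sub i : {subset mkseq om i <= l} by move=> y /mapP[j _ ->].
suff gc : good (rcons (mkseq om (p (size l1))) c).
  have := (omP (p (size l1))).2.2 c gc.
  by have := (pP (size l1)).1; rewrite /P eqxx ltnNge => /negP.
move=> N; have [q [Nq sub evq]] := (omP (p (size l))).1 N.
have sub_sigma : {subset flatten [seq sigma y | y <- l] <= l}.
  move=> z zs; apply: (om_sub (p (size l))).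
  by rewrite -(prefix l [::]) ?cats0 // mem_cat zs orbT.
have newE : rcons (mkseq om (p (size l1))) c ++
    (rest ++ flatten [seq sigma y | y <- m2] ++ q) =
    mkseq om (p 0) ++ flatten [seq sigma y | y <- m] ++ q.
  rewrite mE map_cat flatten_cat -(prefix _ _ lE) /= sb cat_rcons.
  by rewrite -!catA /= -?catA.
exists (rest ++ flatten [seq sigma y | y <- m2] ++ q); split.
- by rewrite !size_cat !(leq_trans Nq) // addnA leq_addl.
- rewrite newE => z; rewrite 2!mem_cat => /orP[/om_sub //|/orP[zf|zq]].
    exact: (flatten_sub sub_wu sub_sigma).
  by apply: sub; rewrite mem_cat zq orbT.
- rewrite newE ev_cat [ev (_ ++ q)]ev_cat -ev_blocks // -evq -(prefix l [::]) ?cats0 //.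
  by rewrite ev_cat [ev (mkseq _ _ ++ _)]ev_cat mulgA.
Qed.

End LongerIdentity.

(** * The varieties NILP_k *)

Lemma letters_linear k : 0 < k -> letters (linear_word k) = iota 0 k.
Proof. by case: k. Qed.

Section Absorbing.
Variable S : semigroup.
Implicit Types a b : unitized S.

Lemma absorbing_unique a b : absorbing a -> absorbing b -> a = b.
Proof. by move=> aa ab; rewrite -(aa b).1 (ab a).2. Qed.

Lemma absorbing_factor a b c : absorbing b -> absorbing (a * b * c)%g.
Proof. by move=> bb; rewrite (bb a).2 (bb c).1. Qed.

Lemma absorbing_prod (g : nat -> unitized S) (t : seq nat) y :
  y \in t -> absorbing (g y) -> absorbing (\prod_(z <- t) g z)%g.
Proof.
case/splitPr => t1 t2 gy; rewrite big_cat big_cons /= mulgA.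
exact: absorbing_factor.
Qed.

Lemma absorbing_fresh u : satisfies S (wmul u (letter (fresh u)), u) ->
    satisfies S (wmul (letter (fresh u)) u, u) ->
    forall f : nat -> unitized S, (forall y, nonunit (f y)) ->
  absorbing (\prod_(y <- letters u) f y)%g.
Proof.
move=> Sr Sl f Pf t; have [->|/eqP Pt] := eqVneq t 1%g.
  by rewrite mul1g mulg1.
pose g y := if y == fresh u then t else f y.
have Pg y : nonunit (g y) by rewrite /g; case: ifP.
have gE : (\prod_(y <- letters u) g y = \prod_(y <- letters u) f y)%g.
  apply: eq_big_seq => y yu; rewrite /g ifN //.
  by apply: contraTneq yu => ->; apply: fresh_notin.
have gt : (\prod_(y <- letters (letter (fresh u))) g y = t)%g.
  by rewrite big_seq1 /g eqxx.
have := satisfies_prod Sr Pg; have := satisfies_prod Sl Pg.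
by rewrite !letters_wmul !big_cat /= gt gE.
Qed.

Lemma satisfies_absorbing u w :
    (forall f : nat -> unitized S, (forall y, nonunit (f y)) ->
       absorbing (\prod_(y <- letters u) f y)%g /\
       absorbing (\prod_(y <- letters w) f y)%g) ->
  satisfies S (u, w).
Proof.
move=> uw; apply: prod_satisfies => g Pg.
by have [ua wa] := uw g Pg; apply: absorbing_unique.
Qed.

Lemma members_NILP k : 0 < k -> members (NILP k) S <->
  forall f : nat -> unitized S, (forall y, nonunit (f y)) ->
    absorbing (\prod_(y <- iota 0 k) f y)%g.
Proof.
move=> k0; rewrite -letters_linear //; set v := linear_word k.
have vE : (v.1, rcons v.2 (fresh v)) = wmul v (letter (fresh v)).
  exact: word_rcons.
split=> [SN f Pf|Sf e].
  by apply: absorbing_fresh Pf; [rewrite -vE|]; apply: SN; [left|right].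
case=> ->; rewrite ?vE; apply: satisfies_absorbing => f Pf; split; try exact: Sf.
  rewrite letters_wmul big_cat -[X in absorbing (X * _)%g]mul1g.
  exact/absorbing_factor/Sf.
rewrite (_ : letters _ = letters (letter (fresh v)) ++ letters v) // big_cat /=.
by rewrite -[X in absorbing X]mulg1; apply/absorbing_factor/Sf.
Qed.

Lemma NILP_prod k (f : nat -> unitized S) t : 0 < k -> members (NILP k) S ->
    (forall y, nonunit (f y)) -> k <= size t ->
  absorbing (\prod_(y <- t) f y)%g.
Proof.
move=> k0 /(members_NILP k0) SN Pf kt; rewrite -(cat_take_drop k t) big_cat /=.
rewrite -[X in absorbing (X * _)%g]mul1g; apply: absorbing_factor.
have -> : take k t = [seq nth 0 t i | i <- iota 0 k].
  rewrite map_nth_iota0 //.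
by rewrite big_map; apply: SN.
Qed.

Lemma NILP_of_uniq (l : seq nat) : 0 < size l -> uniq l ->
    (forall f : nat -> unitized S, (forall y, nonunit (f y)) ->
       absorbing (\prod_(y <- l) f y)%g) ->
  members (NILP (size l)) S.
Proof.
move=> l0 ul la; apply/members_NILP => // f Pf.
rewrite -(index_iota_prefix ul (esym (cats0 l))) big_map.
by apply: la.
Qed.

End Absorbing.

Lemma le_NILP j k : 0 < j -> j <= k -> (NILP j <= NILP k)%O.
Proof.
move=> j0 jk; apply/le_membersP => S SN; apply/members_NILP.
  exact: leq_trans jk.
by move=> f Pf; apply: (NILP_prod j0 SN Pf); rewrite size_iota.
Qed.

(** If the contents of the two sides differ, sending a suitable letter to zero
    proves the claim. Otherwise the second side is strictly longer. *)
Lemma NILP_of_linear_identity (V : variety) u w :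
    nil_variety V -> theory V (u, w) -> uniq (letters u) ->
    ~~ perm_eq (letters u) (letters w) ->
  (V <= NILP (size (letters u)))%O.
Proof.
move=> [n n0 hn] Vuw ul np; apply/le_membersP => S VS.
apply: NILP_of_uniq => // f Pf.
have Suw := Vuw S VS.
(* Sending a letter to zero does not change a word that avoids it. *)
have missing v v' y : satisfies S (v, v') -> y \in letters v ->
    y \notin letters v' -> absorbing (\prod_(x <- letters v') f x)%g.
  move=> Svv' yv yv'; pose g x := if x == y then (f 0 ^+ n)%g else f x.
  have Pg x : nonunit (g x).
    by rewrite /g; case: ifP => // _; apply: nonunit_exp.
  have <- : (\prod_(x <- letters v') g x = \prod_(x <- letters v') f x)%g.
    apply: eq_big_seq => x xv; rewrite /g ifN //.
    by apply: contraNneq yv' => <-.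
  rewrite -(satisfies_prod Svv' Pg); apply: (absorbing_prod yv).
  by rewrite /g eqxx; apply: hn.
have [uw|/allPn[y yu yw]] := boolP (all [in letters w] (letters u)); last first.
  by rewrite (satisfies_prod Suw) //; apply: missing Suw yu yw.
have [wu|/allPn[y yw yu]] := boolP (all [in letters u] (letters w)); last first.
  by apply: missing yw yu => h; rewrite [LHS](esym (Suw h)).
move/allP: uw => uw; move/allP: wu => wu.
apply: (absorbing_of_longer (n := n) (w := w)) => //; first exact: hn.
rewrite ltnNge; apply: contra np => sz.
apply: uniq_perm => //; last by move=> y; apply/idP/idP; [apply: uw|apply: wu].
exact: leq_size_uniq ul uw sz.
Qed.

(** * A chain of commutative nil-varieties *)

Section Lincom.
Variable L : pred nat.

(** The words that are not zero in the variety given by xy = yx, x^2 = 0 and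
    x_1...x_k = 0 for the lengths k in [L]. *)
Definition alive (u : word) : bool :=
  uniq (letters u) && ~~ L (size (letters u)).

Definition lincom_form (u : word) : option (seq nat) :=
  if alive u then Some (sort leq (letters u)) else None.

Lemma alive_perm u w : perm_eq (letters u) (letters w) -> alive u = alive w.
Proof. by move=> uw; rewrite /alive (perm_uniq uw) (perm_size uw). Qed.

Lemma lincom_formP u w : lincom_form u = lincom_form w <->
  (~~ alive u /\ ~~ alive w) \/ perm_eq (letters u) (letters w).
Proof.
rewrite /lincom_form; split=> [|[[/negbTE -> /negbTE ->] //|uw]].
  case: ifP => au; case: ifP => aw //; last by left.
  case=> e; right; apply/(perm_sortP leq_total leq_trans anti_leq); exact: e.
rewrite (alive_perm uw); case: ifP => // _; congr Some.
exact/(perm_sortP leq_total leq_trans anti_leq).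
Qed.

Hypothesis L_up : forall i j, i <= j -> L i -> L j.

Lemma dead_mono u w : (uniq (letters w) -> uniq (letters u)) ->
  size (letters u) <= size (letters w) -> ~~ alive u -> ~~ alive w.
Proof.
move=> uw sz; apply: contra => /andP[/uw uu Lw].
by rewrite /alive uu; apply: contra Lw; apply: L_up.
Qed.

Lemma uniq_subst sigma u : uniq (letters (subst sigma u)) -> uniq (letters u).
Proof.
rewrite letters_subst; elim: (letters u) => // y s IHs.
have flatten_cons a (b : seq (seq nat)) : flatten (a :: b) = a ++ flatten b by [].
rewrite map_cons flatten_cons cat_uniq => /and3P[_ hs /IHs us].
rewrite cons_uniq us andbT; apply: contra hs => ys; apply/hasP.
exists (sigma y).1; last by rewrite inE eqxx.
by apply/flattenP; exists (letters (sigma y)); [apply: map_f|rewrite inE eqxx].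
Qed.

Lemma lincom_form_inv : fully_invariant lincom_form.
Proof.
have dl u w : ~~ alive u -> ~~ alive (wmul u w).
  apply: dead_mono; last by rewrite size_wmul leq_addr.
  by rewrite letters_wmul cat_uniq => /and3P[].
have dr u w : ~~ alive w -> ~~ alive (wmul u w).
  apply: dead_mono; last by rewrite size_wmul leq_addl.
  by rewrite letters_wmul cat_uniq => /and3P[].
split=> [u u' w w' /lincom_formP uu' /lincom_formP ww'|
         sigma u w /lincom_formP uw]; apply/lincom_formP.
  case: uu' => [[du du']|uu']; first by left; split; apply: dl.
  case: ww' => [[dw dw']|ww']; first by left; split; apply: dr.
  by right; rewrite !letters_wmul perm_cat.
case: uw => [[du dw]|uw]; last first.
  by right; rewrite !letters_subst perm_flatten // perm_map.
left; split; [apply: dead_mono du|apply: dead_mono dw]; rewrite ?size_subst //.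
  exact: uniq_subst.
exact: uniq_subst.
Qed.

Lemma dead_absorbing S u (f : nat -> unitized S) :
    members (kvar lincom_form) S -> ~~ alive u -> (forall y, nonunit (f y)) ->
  absorbing (\prod_(y <- letters u) f y)%g.
Proof.
move=> SC du; apply: absorbing_fresh; apply: SC; apply/lincom_formP; left;
  split=> //; apply: dead_mono du; rewrite ?size_wmul ?leq_addr ?leq_addl //;
  by rewrite letters_wmul cat_uniq => /and3P[].
Qed.

Lemma lincom_nil : nil_variety (kvar lincom_form).
Proof.
exists 2 => // S SC s Ps.
have du : ~~ alive (0, [:: 0]) by [].
have := dead_absorbing SC du (fun=> Ps).
by rewrite !big_cons big_nil mulg1.
Qed.

(** An identity that fails in the commutative variety has a nonzero side, which
    is a linear word, and another side that is not a permutation of it. *)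
Lemma NILP_of_not_le_lincom (V : variety) :
    nil_variety V -> ~ (kvar lincom_form <= V)%O ->
  exists k, [/\ 0 < k, ~~ L k & (V <= NILP k)%O].
Proof.
move=> nV /(not_le_kvar lincom_form_inv)[u [w [Vuw nuw]]].
have step v v' : theory V (v, v') -> alive v ->
    ~~ perm_eq (letters v) (letters v') ->
    exists k, [/\ 0 < k, ~~ L k & (V <= NILP k)%O].
  move=> th /andP[uv Lv] np; exists (size (letters v)); split=> //.
  exact: NILP_of_linear_identity th uv np.
have np : ~~ perm_eq (letters u) (letters w).
  by apply/negP => uw; apply: nuw; apply/lincom_formP; right.
have [au|du] := boolP (alive u); first exact: step Vuw au np.
have [aw|dw] := boolP (alive w); last first.
  by case: nuw; apply/lincom_formP; left.
by apply: (step w u) => //; [apply: theory_sym|rewrite perm_sym].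
Qed.

Lemma lincom_not_le_NILP k : 0 < k -> ~~ L k ->
  ~ (kvar lincom_form <= NILP k)%O.
Proof.
move=> k0 Lk /(le_kvarP lincom_form_inv).
move/(_ (wmul (linear_word k) (letter (fresh (linear_word k)))) (linear_word k)).
have th : theory (NILP k)
    (wmul (linear_word k) (letter (fresh (linear_word k))), linear_word k).
  by move=> S SN; rewrite -word_rcons; apply: SN; left.
move=> /(_ th)/lincom_formP[[_]|/perm_size].
  by rewrite /alive letters_linear // size_iota iota_uniq Lk.
rewrite size_wmul letters_linear // size_iota addn1 => /eqP.
by rewrite -[X in _ == X]addn0 -addn1 eqn_add2l.
Qed.

End Lincom.

Notation COMNIL := (kvar (lincom_form pred0)).
Notation COMNILP k := (kvar (lincom_form (leq k))).

Lemma pred0_up i j : i <= j -> (pred0 : pred nat) i -> (pred0 : pred nat) j.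
Proof. by []. Qed.

Lemma geq_up k i j : i <= j -> leq k i -> leq k j.
Proof. by move=> ij ki; apply: leq_trans ij. Qed.

Lemma lincom_le (L L' : pred nat) : (forall i j, i <= j -> L' i -> L' j) ->
  (forall i, L i -> L' i) -> (kvar (lincom_form L') <= kvar (lincom_form L))%O.
Proof.
move=> up LL'; apply/le_membersP => S SC [u w] uw; apply: SC.
apply/lincom_formP; move/lincom_formP: uw => [[du dw]|uw]; [left|by right].
have dead v : ~~ alive L v -> ~~ alive L' v.
  by apply: contra => /andP[uv Lv]; rewrite /alive uv; apply: contra Lv; apply: LL'.
by split; apply: dead.
Qed.

Lemma COMNILP_le_NILP k : 0 < k -> (COMNILP k <= NILP k)%O.
Proof.
move=> k0; apply/le_membersP => S SC; apply/members_NILP => // f Pf.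
rewrite -letters_linear //; apply: (dead_absorbing (@geq_up k) SC) => //.
by rewrite /alive letters_linear // size_iota leqnn andbF.
Qed.

Lemma le_COMNILP (x : variety) k : 0 < k ->
  (x <= COMNIL)%O -> (x <= NILP k)%O -> (x <= COMNILP k)%O.
Proof.
move=> k0 /le_membersP xC /le_membersP xN; apply/le_membersP => S xS [u w].
move=> /lincom_formP[[du dw]|uw]; last first.
  by apply: (xC S xS); apply/lincom_formP; right.
have dead v (f : nat -> unitized S) : (forall y, nonunit (f y)) ->
    ~~ alive (leq k) v -> absorbing (\prod_(y <- letters v) f y)%g.
  rewrite negb_and negbK => Pf /orP[nu|kv]; last first.
    exact: NILP_prod (xN S xS) Pf kv.
  apply: (dead_absorbing pred0_up (xC S xS)) => //.
  by rewrite /alive (negbTE nu).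
by apply: satisfies_absorbing => f Pf; split; apply: dead.
Qed.

Lemma COMNILP1_trivial : trivial_variety (COMNILP 1).
Proof.
apply/trivial_varietyP => S SC x y.
have /(_ (fun i => if i == 0 then x else y)) : satisfies S (letter 0, letter 1).
  by apply: SC; apply/lincom_formP; left; split; rewrite /alive.
by [].
Qed.

Lemma COMNILP_lt k : 0 < k -> ~ (COMNILP k.+1 <= COMNILP k)%O.
Proof.
move=> k0 /le_trans/(_ (COMNILP_le_NILP k0)).
by apply: lincom_not_le_NILP => //; [apply: geq_up|rewrite -ltnNge].
Qed.

Lemma COMNILP_cover (x : variety) k : 0 < k -> (x <= COMNIL)%O ->
  ~ (COMNILP k.+1 <= x)%O -> (x <= COMNILP k)%O.
Proof.
move=> k0 xC /(NILP_of_not_le_lincom (@geq_up k.+1)).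
have nx : nil_variety x by apply: nil_le xC (lincom_nil _); exact: pred0_up.
move=> /(_ nx)[j [j0]]; rewrite -ltnNge ltnS => jk xN.
apply: le_COMNILP => //; apply: le_trans xN _; exact: le_NILP.
Qed.

(** So COMNIL is the least nil-variety that is not nilpotent. *)
Lemma nilpotent_or_COMNIL (V : variety) : nil_variety V ->
  (COMNIL <= V)%O \/ exists2 k, 0 < k & (V <= NILP k)%O.
Proof.
move=> nV; have [?|nC] := pselect (COMNIL <= V)%O; [by left|right].
by have [k [k0 _ VN]] := NILP_of_not_le_lincom pred0_up nV nC; exists k.
Qed.

Lemma COMNIL_not_le_NILP k : 0 < k -> ~ (COMNIL <= NILP k)%O.
Proof. by move=> k0; apply: lincom_not_le_NILP. Qed.

(** * Nilpotent varieties *)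

Lemma sgpowP (S : semigroup) k : 0 < k -> sgpow S k =
  [set a | exists f : nat -> S, word_eval f (linear_word k) = a].
Proof.
case: k => // k _; elim: k => [|k IHk].
  by apply/seteqP; split=> // a _; exists (fun=> a).
have -> : sgpow S k.+2 = setmul (sgpow S k.+1) setT by [].
have lE : linear_word k.+2 = wmul (linear_word k.+1) (letter k.+1).
  have e : iota 1 k.+1 = iota 1 k ++ [:: k.+1] by rewrite -(addn1 k) iotaD (addnC 1).
  by rewrite /linear_word -[k.+2.-1]/(k.+1) e.
rewrite IHk lE; apply/seteqP; split=> a.
  move=> [_ [f <-] [b _ <-]].
  exists (fun y => if y == k.+1 then b else f y).
  rewrite word_eval_rcons eqxx; congr sgmul; apply: inj_unitized_inj.
  rewrite !word_evalE letters_linear //; apply: eq_big_seq => y.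
  by rewrite mem_iota add0n => /andP[_ yk]; rewrite ltn_eqF.
move=> [f <-]; rewrite word_eval_rcons.
by exists (word_eval f (linear_word k.+1)); [exists f|exists (f k.+1)].
Qed.

Lemma absorbing_zero (S : semigroup) (a : S) :
  absorbing (inj_unitized a) <-> is_zero a.
Proof.
split=> [aa x|za [x|]].
- by have [l r] := aa (inj_unitized x); split; apply: inj_unitized_inj.
- by have [l r] := za x; split; rewrite -[Some x]/(inj_unitized x) -inj_unitizedM ?l ?r.
- by split; rewrite ?mul1g ?mulg1.
Qed.

Lemma nilpotent_semigroup_NILP (S : semigroup) :
  nilpotent_semigroup S <-> exists2 k, 0 < k & members (NILP k) S.
Proof.
split=> [[z zz [k k0 Sk]]|[k k0 SN]]; last first.
  have [x] := sg_nonempty S.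
  have ev_zero (f : nat -> S) : is_zero (word_eval f (linear_word k)).
    apply/absorbing_zero; rewrite word_evalE letters_linear //.
    by apply: (members_NILP _ k0).1 => // y; apply: nonunit_inj.
  exists (word_eval (fun=> x) (linear_word k)) => //; exists k => //.
  rewrite sgpowP //; apply/seteqP; split=> [a [f <-] /=|_ ->]; last by exists (fun=> x).
  by rewrite -(ev_zero f (word_eval (fun=> x) (linear_word k))).1 (ev_zero (fun=> x) _).2.
exists k => //; apply/members_NILP => // g Pg.
rewrite -letters_linear //.
have /choice[f fE] : forall y, exists x, g y = inj_unitized x.
  by move=> y; apply: nonunitP.
under eq_bigr do rewrite fE; rewrite -word_evalE.
have : sgpow S k (word_eval f (linear_word k)) by rewrite sgpowP //; exists f.
by rewrite Sk => ->; apply/absorbing_zero.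
Qed.

(** The nilpotency degrees of the members are uniformly bounded because the
    relatively free semigroup of countable rank is a member. *)
Lemma nilpotent_varietyP (V : variety) :
  nilpotent_variety V <-> exists2 k, 0 < k & (V <= NILP k)%O.
Proof.
split=> [nV|[k k0 /le_membersP VN] S /VN SN]; last first.
  by apply/nilpotent_semigroup_NILP; exists k.
pose F := qsemigroup (theory_class_inv V).
have FP u w : satisfies F (u, w) <-> theory V (u, w).
  rewrite qsemigroupP; exact: theory_classP.
have VF : members V F by apply/memP => -[u w] /FP.
have /nilpotent_semigroup_NILP[k k0 FN] := nV F VF.
by exists k => //; apply/le_theoryP => -[u w] /(_ F FN)/FP.
Qed.

(** * Nilpotent varieties have maximal subvarieties *)

(** This property separates COMNIL from the nilpotent varieties. *)
Definition dense_below (V : variety) : Prop :=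
  ~ trivial_variety V /\ forall x : variety, (x <= V)%O -> ~ (V <= x)%O ->
    exists y : variety, [/\ (x <= y)%O, ~ (y <= x)%O, (y <= V)%O & ~ (V <= y)%O].

Section FiniteBelow.
Variables (k : nat) (V : variety).
Hypothesis k0 : 0 < k.
Hypothesis VN : (V <= NILP k)%O.

(** Words of length at most k need no more than 2k letters in an identity, so
    finitely many identities tell subvarieties of [V] apart. The sequences here
    stand for words through [to_word], which maps the empty one to a letter. *)
Let short := k.-bseq 'I_(2 * k).+1.

Let short_word (b : short) : word := to_word [seq val i | i <- b].

Let fingerprint (x : variety) : {set short * short} :=
  finset (fun p => `[< theory x (short_word p.1, short_word p.2) >]).

Let truncate (u : word) := if size (letters u) <= k then u else linear_word k.

Let truncateP x u : (x <= V)%O -> theory x (u, truncate u).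
Proof.
move=> xV; rewrite /truncate; case: ifP => [_|/negbT]; first exact: theory_refl.
rewrite -ltnNge => ku.
move=> S xS; have SN : members (NILP k) S.
  by have /le_membersP := le_trans xV VN; apply.
apply: satisfies_absorbing => f Pf; split; apply: NILP_prod SN Pf _ => //.
  exact: ltnW.
by rewrite letters_linear // size_iota.
Qed.

Let size_truncate u : size (letters (truncate u)) <= k.
Proof. by rewrite /truncate; case: ifP => // _; rewrite letters_linear // size_iota. Qed.

(** Renaming each letter to its index in the concatenation of both sides can be
    undone by a substitution. *)
Let short_complete u w : size (letters u) <= k -> size (letters w) <= k ->
  exists p : short * short, forall x : variety,
    theory x (u, w) <-> theory x (short_word p.1, short_word p.2).
Proof.
move=> su sw; have [l lE] : exists l, l = letters u ++ letters w.
  by exists (letters u ++ letters w).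
have sl : size l <= 2 * k by rewrite lE size_cat mul2n -addnn leq_add.
have short_of v : size (letters v) <= k -> {subset letters v <= l} ->
    exists b : short, short_word b = subst (fun y => letter (index y l)) v.
  move=> sv vl.
  have sb : size [seq inord (index y l) : 'I_(2 * k).+1 | y <- letters v] <= k.
    by rewrite size_map.
  exists (Bseq sb); apply: letters_inj; rewrite letters_subst.
  rewrite letters_to_word; last by rewrite !size_map.
  rewrite -[LHS]map_comp; elim: (letters v) vl {sv sb} => // y s IHs vl.
  rewrite !map_cons IHs => [|z zs]; last by apply: vl; rewrite inE zs orbT.
  rewrite -cat1s; congr ([:: _] ++ _); apply: inordK.
  rewrite ltnS (leq_trans _ sl) // ltnW // index_mem.
  by apply: vl; rewrite inE eqxx.
have back v : {subset letters v <= l} ->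
    subst (fun i => letter (nth 0 l i)) (subst (fun y => letter (index y l)) v) = v.
  move=> vl; apply: letters_inj; rewrite !letters_subst.
  elim: (letters v) vl => // y s IHs vl.
  have sub_sl : {subset s <= l} by move=> z zs; apply: vl; rewrite inE zs orbT.
  have := IHs sub_sl.
  by rewrite /= nth_index => [->//|]; apply: vl; rewrite inE eqxx.
have ul : {subset letters u <= l} by move=> y yu; rewrite lE mem_cat yu.
have wl : {subset letters w <= l} by move=> y yw; rewrite lE mem_cat yw orbT.
have [bu uE] := short_of u su ul; have [bw wE] := short_of w sw wl.
exists (bu, bw) => x; rewrite /= uE wE; split; first exact: theory_subst.
by move=> /(theory_subst (fun i => letter (nth 0 l i))); rewrite !back.
Qed.

Let fingerprint_proper (x y : variety) : (x <= y)%O -> (y <= V)%O -> ~ (y <= x)%O ->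
  fingerprint y \proper fingerprint x.
Proof.
move=> xy yV nyx; apply/properP; split.
  apply/fintype.subsetP => p; rewrite !finset.in_set => /asboolP th; apply/asboolP.
  by move/le_theoryP: xy => h; apply: h.
have [[u w] xuw yuw] : exists2 e, theory x e & ~ theory y e.
  apply: contrapT => no; apply: nyx; apply/le_theoryP => e xe.
  by apply: contrapT => nye; apply: no; exists e.
have tr z : (z <= V)%O -> theory z (u, w) <-> theory z (truncate u, truncate w).
  move=> zV; split=> th.
    apply: theory_trans (theory_sym (truncateP u zV)) _.
    by apply: theory_trans th (truncateP w zV).
  apply: theory_trans (truncateP u zV) _.
  by apply: theory_trans th (theory_sym (truncateP w zV)).
have [p pP] := short_complete (size_truncate u) (size_truncate w).
exists p; rewrite finset.in_set.
  by apply/asboolP/pP/tr => //; apply: le_trans xy yV.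
by apply/asboolP => /pP/(tr y yV).
Qed.

(** A proper subvariety with the fewest short identities is maximal. *)
Lemma not_dense_below : ~ dense_below V.
Proof.
move=> [ntV dense].
have none n : forall x : variety, (x <= V)%O -> ~ (V <= x)%O ->
    #|fingerprint x| < n -> False.
  elim: n => // n IHn x xV Vx; rewrite ltnS => xn.
  have [y [xy nyx yV nVy]] := dense x xV Vx.
  by apply: (IHn y yV nVy); apply: leq_trans xn; apply/proper_card/fingerprint_proper.
have inv : fully_invariant (fun _ : word => tt) by [].
pose triv := kvar (fun _ : word => tt).
have tt_triv : trivial_variety triv.
  apply/trivial_varietyP => S St x y.
  exact: (St (letter 0, letter 1) erefl (fun i => if i == 0 then x else y)).
apply: (none #|fingerprint triv|.+1 triv) => // /le_trivial h; exact/ntV/h.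
Qed.

End FiniteBelow.

(** * First-order descriptions *)

Lemma zm_likeP z : zm_like z <-> z = ZM.
Proof.
split=> [|->]; first exact: zm_like_ZM.
have nC : nil_variety COMNIL by apply: lincom_nil; exact: pred0_up.
split; [exact: nontrivial_ZM|exact: join_covered_ZM|].
exists COMNIL; split; last exact/nil_varietyP.
- apply: ZM_le_nil nC _ => tC.
  exact: (@COMNIL_not_le_NILP 1 isT (tC _)).
- move=> /(le_kvar_kvar (0, [:: 1]) (0, [:: 2]) (lincom_form_inv pred0_up)).
  by move=> /(_ erefl).
Qed.

Definition lattice_nil (V : variety) : Prop :=
  forall z, zm_like z ->
  forall x : variety, (x <= V)%O -> trivial_variety x \/ (z <= x)%O.

Lemma lattice_nilP V : lattice_nil V <-> nil_variety V.
Proof.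
rewrite nil_varietyP; split=> [h|h z /zm_likeP -> //].
by apply: h; apply/zm_likeP.
Qed.

Definition lattice_comnil (c : variety) : Prop :=
  lattice_nil c /\ (dense_below c /\
    forall V, lattice_nil V -> dense_below V -> (c <= V)%O).

Lemma lattice_comnilP c : lattice_comnil c <-> c = COMNIL.
Proof.
have nC : nil_variety COMNIL by apply: lincom_nil; exact: pred0_up.
have least V : nil_variety V -> dense_below V -> (COMNIL <= V)%O.
  by move=> /nilpotent_or_COMNIL[//|[k k0 VN]] /(not_dense_below k0 VN).
have dC : dense_below COMNIL.
  split=> [tC|x xC Cx]; first exact: (@COMNIL_not_le_NILP 1 isT (tC _)).
  have [//|[k k0 xN]] := nilpotent_or_COMNIL (nil_le xC nC).
  have CkC j : (COMNILP j <= COMNIL)%O by apply: lincom_le => //; exact: geq_up.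
  exists (COMNILP k.+1); split=> //.
  - apply: le_trans (le_COMNILP k0 xC xN) _; apply: lincom_le => [|i].
      exact: geq_up.
    exact: ltnW.
  - move=> /le_trans/(_ (le_COMNILP k0 xC xN)); exact: COMNILP_lt.
  - move=> /le_trans/(_ (COMNILP_le_NILP (ltn0Sn k))).
    exact: COMNIL_not_le_NILP.
split=> [[/lattice_nilP nc [dc lc]]|->].
  by apply/le_anti; rewrite lc ?least //; apply/lattice_nilP.
by split; [exact/lattice_nilP|split=> // V /lattice_nilP; exact: least].
Qed.

Definition lattice_nilpotent (V : variety) : Prop :=
  lattice_nil V /\ forall c, lattice_comnil c -> ~ (c <= V)%O.

Lemma lattice_nilpotentP V : lattice_nilpotent V <-> exists2 k, 0 < k & (V <= NILP k)%O.
Proof.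
split=> [[/lattice_nilP nV nC]|[k k0 VN]].
  have [|//] := nilpotent_or_COMNIL nV.
  by move/(nC _ ((lattice_comnilP _).2 erefl)).
split.
  apply/lattice_nilP; exists k => // S VS s Ps.
  have /le_membersP/(_ S VS) SN := VN.
  have <- : (\prod_(y <- iota 0 k) s = s ^+ k)%g.
    rewrite big_const_seq count_predT size_iota.
    by elim: (k) => // j IHj; rewrite expgS /= IHj.
  exact: (members_NILP _ k0).1 SN (fun=> s) (fun=> Ps).
by move=> c /lattice_comnilP -> /le_trans/(_ VN); exact: COMNIL_not_le_NILP.
Qed.

(** The index is shifted: [lattice_chain k] describes [COMNILP k.+1], and
    [COMNILP 1] is trivial. *)
Fixpoint lattice_chain (k : nat) (c : variety) : Prop :=
  if k is k'.+1 then
    exists C, lattice_comnil C /\ exists b, lattice_chain k' b /\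
      ((b <= c)%O /\ (~ (c <= b)%O /\ ((c <= C)%O /\
        forall x : variety, (b <= x)%O -> ~ (x <= b)%O -> (x <= C)%O -> (c <= x)%O)))
  else trivial_variety c.

Lemma lattice_chainP k c : lattice_chain k c <-> c = COMNILP k.+1.
Proof.
elim: k c => [|k IHk] c.
  split=> [tc|->]; last exact: COMNILP1_trivial.
  by apply/le_anti; rewrite tc COMNILP1_trivial.
have lt_le : (COMNILP k.+1 <= COMNILP k.+2)%O.
  by apply: lincom_le => [|i]; [exact: geq_up|exact: ltnW].
have le_C : (COMNILP k.+2 <= COMNIL)%O by apply: lincom_le => //; exact: geq_up.
have least x : ~ (x <= COMNILP k.+1)%O -> (x <= COMNIL)%O -> (COMNILP k.+2 <= x)%O.
  by move=> nx xC; apply: contrapT => /(COMNILP_cover (ltn0Sn k) xC).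
split=> [[C [/lattice_comnilP -> [b [/IHk -> [bc [cb [cC cl]]]]]]]|->].
  by apply/le_anti; rewrite least // cl //; exact: COMNILP_lt.
exists COMNIL; split; first exact/lattice_comnilP.
exists (COMNILP k.+1); split; first exact/IHk.
split=> //; split; first exact: COMNILP_lt.
split=> //.
by move=> x _ nx xC; apply: least.
Qed.

(** The index [k] of the chain stands for [COMNILP k.+1], the obstruction to
    nilpotency of degree [k]. *)
Definition lattice_NILP (k : nat) (V : variety) : Prop :=
  lattice_nilpotent V /\ forall c, lattice_chain k c ->
    ~ (c <= V)%O /\ forall x, lattice_nilpotent x -> ~ (c <= x)%O -> (x <= V)%O.

Lemma lattice_NILPP k V : 0 < k -> lattice_NILP k V <-> V = NILP k.
Proof.
move=> k0; have nN : lattice_nilpotent (NILP k) by apply/lattice_nilpotentP; exists k.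
have not_le : ~ (COMNILP k.+1 <= NILP k)%O.
  by apply: lincom_not_le_NILP => //; [exact: geq_up|rewrite -ltnNge].
have greatest x : lattice_nilpotent x -> ~ (COMNILP k.+1 <= x)%O -> (x <= NILP k)%O.
  move=> [/lattice_nilP nx _] /(NILP_of_not_le_lincom (@geq_up k.+1) nx)[j [j0]].
  by rewrite -ltnNge ltnS => jk xN; apply: le_trans xN _; exact: le_NILP.
split=> [[nV /(_ _ ((lattice_chainP k _).2 erefl))[cV Vg]]|->].
  by apply/le_anti; rewrite greatest // Vg.
by split=> // c /lattice_chainP ->.
Qed.

(** * Predicates given by first-order formulas *)

Definition fo_definable (n : nat) (P : ('I_n -> variety) -> Prop) : Prop :=
  exists phi : formula n, forall e : 'I_n -> SEM, holds phi e <-> P e.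

Definition fo_predicate (P : variety -> Prop) : Prop :=
  forall n (i : 'I_n), fo_definable (fun e => P (e i)).

Section Closure.
Variable n : nat.
Implicit Types P Q R T : ('I_n -> variety) -> Prop.

Lemma fo_le (i j : 'I_n) : fo_definable (fun e => (e i <= e j)%O).
Proof.
exists (FEq (LMeet (LVar i) (LVar j)) (LVar i)) => e /=.
by rewrite leEmeet; split=> [->|/eqP].
Qed.

Lemma fo_le_join (i j k : 'I_n) : fo_definable (fun e => (e i <= e j `|` e k)%O).
Proof.
exists (FEq (LMeet (LVar i) (LJoin (LVar j) (LVar k))) (LVar i)) => e /=.
by rewrite leEmeet; split=> [->|/eqP].
Qed.

Lemma fo_not P : fo_definable P -> fo_definable (fun e => ~ P e).
Proof. by move=> [p hp]; exists (FNot p) => e /=; rewrite hp. Qed.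

Lemma fo_and P Q : fo_definable P -> fo_definable Q ->
  fo_definable (fun e => P e /\ Q e).
Proof. by move=> [p hp] [q hq]; exists (FAnd p q) => e /=; rewrite hp hq. Qed.

Lemma fo_and3 P Q R : fo_definable P -> fo_definable Q -> fo_definable R ->
  fo_definable (fun e => [/\ P e, Q e & R e]).
Proof.
move=> [p hp] [q hq] [r hr]; exists (FAnd p (FAnd q r)) => e /=.
by rewrite hp hq hr; split=> [[? []]|[]].
Qed.

Lemma fo_and4 P Q R T :
    fo_definable P -> fo_definable Q -> fo_definable R -> fo_definable T ->
  fo_definable (fun e => [/\ P e, Q e, R e & T e]).
Proof.
move=> [p hp] [q hq] [r hr] [t ht]; exists (FAnd (FAnd p q) (FAnd r t)) => e /=.
by rewrite hp hq hr ht; split=> [[[? ?] []]|[]].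
Qed.

Lemma fo_or P Q : fo_definable P -> fo_definable Q ->
  fo_definable (fun e => P e \/ Q e).
Proof. by move=> [p hp] [q hq]; exists (FOr p q) => e /=; rewrite hp hq. Qed.

Lemma fo_imp P Q : fo_definable P -> fo_definable Q ->
  fo_definable (fun e => P e -> Q e).
Proof. by move=> [p hp] [q hq]; exists (FImp p q) => e /=; rewrite hp hq. Qed.

(** Writing the quantified variety and the environment as separate arguments of
    [P] lets unification find [P], with no de Bruijn bookkeeping. *)
Lemma fo_all (P : variety -> ('I_n -> variety) -> Prop) :
    fo_definable (fun e : 'I_n.+1 -> variety =>
      P (e ord0) (fun i => e (lift ord0 i))) ->
  fo_definable (fun e => forall x, P x e).
Proof.
move=> [p hp]; exists (FAll p) => e /=; split=> h x; have := h x; rewrite hp;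
  by rewrite /env_cons unlift_none; under eq_fun do rewrite liftK.
Qed.

Lemma fo_ex (P : variety -> ('I_n -> variety) -> Prop) :
    fo_definable (fun e : 'I_n.+1 -> variety =>
      P (e ord0) (fun i => e (lift ord0 i))) ->
  fo_definable (fun e => exists x, P x e).
Proof.
move=> [p hp]; exists (FEx p) => e /=; split=> -[x h]; exists x; move: h; rewrite hp;
  by rewrite /env_cons unlift_none; under eq_fun do rewrite liftK.
Qed.

End Closure.

Ltac fo_definability := repeat (cbv beta; first
  [ apply: fo_le | apply: fo_le_join
  | match goal with H : fo_predicate _ |- _ => apply: H end
  | refine (fo_and _ _) | refine (fo_and3 _ _ _) | refine (fo_and4 _ _ _ _)
  | refine (fo_or _ _) | refine (fo_not _)
  | refine (fo_all _) | refine (fo_ex _) | refine (fo_imp _ _) ]).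

Lemma fo_trivial : fo_predicate trivial_variety.
Proof. by move=> n i; rewrite /trivial_variety; fo_definability. Qed.

Lemma fo_dense_below : fo_predicate dense_below.
Proof.
by have := fo_trivial; move=> ? n i; rewrite /dense_below; fo_definability.
Qed.

Lemma fo_zm_like : fo_predicate zm_like.
Proof.
have := fo_trivial; move=> ? n i.
by rewrite /zm_like /join_covered /monolith_extends; fo_definability.
Qed.

Lemma fo_lattice_nil : fo_predicate lattice_nil.
Proof.
have := fo_trivial; have := fo_zm_like; move=> ? ? n i.
by rewrite /lattice_nil; fo_definability.
Qed.

Lemma fo_lattice_comnil : fo_predicate lattice_comnil.
Proof.
have := fo_dense_below; have := fo_lattice_nil; move=> ? ? n i.
by rewrite /lattice_comnil; fo_definability.
Qed.

Lemma fo_lattice_nilpotent : fo_predicate lattice_nilpotent.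
Proof.
have := fo_lattice_comnil; have := fo_lattice_nil; move=> ? ? n i.
by rewrite /lattice_nilpotent; fo_definability.
Qed.

Lemma fo_lattice_chain k : fo_predicate (lattice_chain k).
Proof.
have := fo_trivial; have := fo_lattice_comnil; move=> ? ?.
by elim: k => [|k IHk] n i; rewrite /=; fo_definability.
Qed.

Lemma fo_lattice_NILP k : fo_predicate (lattice_NILP k).
Proof.
have := fo_lattice_chain k; have := fo_lattice_nilpotent; move=> ? ? n i.
by rewrite /lattice_NILP; fo_definability.
Qed.

Lemma definable_fo_predicate (P Q : variety -> Prop) :
  fo_predicate P -> (forall V, P V <-> Q V) -> definable (L := SEM) [set V | Q V].
Proof.
by move=> /(_ 1 ord0)[phi hphi] PQ; exists phi => a; rewrite hphi.
Qed.

Theorem theorem3p2 :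
  definable (L := SEM) [set V | nilpotent_variety V] /\
  (forall k : nat, 0 < k -> definable (L := SEM) [set NILP k]).
Proof.
split=> [|k k0].
  apply: definable_fo_predicate fo_lattice_nilpotent _ => V.
  by rewrite lattice_nilpotentP nilpotent_varietyP.
apply: definable_fo_predicate (@fo_lattice_NILP k) _ => V.
exact: lattice_NILPP.
Qed.
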